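(* Let $n \in \mathbb{N}$. Then $$\sum_{k\in \mathbb{Z}^n} e^{i2\pi kx} = \sum_{k\in \mathbb{Z}^n} \delta_k \in \mathcal{C}^{-n}(\mathbb{R}^n),$$ where both series converge in $S'(\mathbb{R}^n)$.
   Context: $\mathbb{N}=\{1,2,\dots\}$, $\mathbb{N}_0=\mathbb{N}\cup\{0\}$. $S(\mathbb{R}^n)$ is the Schwartz space and $S'(\mathbb{R}^n)$ its dual, the tempered distributions. For $k,x\in\mathbb{R}^n$, $kx=\sum_{j=1}^n k_jx_j$. For $a\in\mathbb{R}^n$, $\delta_a\in S'(\mathbb{R}^n)$ is the Dirac distribution $\delta_a(\varphi)=\varphi(a)$, and $e^{iax}$ is regarded as the tempered distribution generated by the function $x\mapsto e^{iax}$. Fourier transform: for $\varphi\in S(\mathbb{R}^n)$, $\widehat{\varphi}(\xi)=(2\pi)^{-n/2}\int_{\mathbb{R}^n}e^{-ix\xi}\varphi(x)\,dx$ and $\varphi^\vee(\xi)=(2\pi)^{-n/2}\int_{\mathbb{R}^n}e^{ix\xi}\varphi(x)\,dx$, extended to $S'(\mathbb{R}^n)$ by $\widehat T(\varphi)=T(\widehat\varphi)$, $T^\vee(\varphi)=T(\varphi^\vee)$. The spaces $\mathcal{C}^s(\mathbb{R}^n)$: let $\varphi_0\in S(\mathbb{R}^n)$ with $\varphi_0(x)=1$ if $|x|\le 1$ and $\varphi_0(x)=0$ if $|x|\ge 3/2$, and $\varphi_k(x)=\varphi_0(2^{-k}x)-\varphi_0(2^{-k+1}x)$ for $k\in\mathbb{N}$.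 For $s\in\mathbb{R}$, $\mathcal{C}^s(\mathbb{R}^n)=B^s_{\infty,\infty}(\mathbb{R}^n)$ is the collection of all $f\in S'(\mathbb{R}^n)$ such that $\|f\,|\,\mathcal{C}^s(\mathbb{R}^n)\|=\sup_{j\in\mathbb{N}_0,\,x\in\mathbb{R}^n}2^{js}|(\varphi_j\widehat f)^\vee(x)|<\infty$ (the space is independent of the choice of $\varphi_0$, up to equivalent norms). *)

(* Defs.v *)
From HB Require Import structures.
From mathcomp Require Import all_boot all_order all_algebra.
From mathcomp Require Export complex.
From mathcomp Require Import all_classical all_reals all_analysis.
From mathcomp Require Export summability.

Set Implicit Arguments.
Unset Strict Implicit.
Unset Printing Implicit Defensive.
Import Order.TTheory GRing.Theory Num.Theory.
Import numFieldNormedType.Exports.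

Local Open Scope classical_set_scope.
Local Open Scope ring_scope.

Section cons_measure.
Context d (T : measurableType d) (R : realType) (n : nat).
Variables (m1 : {sigma_finite_measure set T -> \bar R}).
Variables (m2 : {sigma_finite_measure set (n.-tuple T) -> \bar R}).

Definition tuple_cons (p : T * n.-tuple T) : n.+1.-tuple T :=
  [tuple of p.1 :: p.2].

Definition cons_measure : set (n.+1.-tuple T) -> \bar R :=
  pushforward (m1 \x m2)%E tuple_cons.

Lemma measurable_tuple_cons : measurable_fun setT tuple_cons.
Proof. exact: measurable_cons. Qed.

Let cons_measure0 : cons_measure set0 = 0%E.
Proof. by rewrite /cons_measure /pushforward preimage_set0 measure0. Qed.

Let cons_measure_ge0 A : (0 <= cons_measure A)%E.
Proof. by rewrite /cons_measure /pushforward measure_ge0. Qed.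

Let cons_measure_sigma_additive : semi_sigma_additive cons_measure.
Proof.
move=> F mF tF mUF; rewrite /cons_measure /pushforward preimage_bigcup.
apply: measure_semi_sigma_additive.
- by move=> k; rewrite -[X in measurable X]setTI; exact: measurable_tuple_cons.
- apply/trivIsetP => /= i j _ _ ij; rewrite -preimage_setI.
  by move/trivIsetP : tF => /(_ _ _ _ _ ij) ->//; rewrite preimage_set0.
- rewrite -preimage_bigcup -[X in measurable X]setTI.
  exact: measurable_tuple_cons.
Qed.

HB.instance Definition _ := isMeasure.Build _ _ _ cons_measure
  cons_measure0 cons_measure_ge0 cons_measure_sigma_additive.

Let cons_measure_sigma_finite : sigma_finite setT cons_measure.
Proof.
have /sigma_finiteP[F [TF ndF Foo]] := sigma_finiteT m1.
have /sigma_finiteP[G [TG ndG Goo]] := sigma_finiteT m2.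
pose g (t : n.+1.-tuple T) := (thead t, [tuple of behead t]) : T * n.-tuple T.
have gK p : g (tuple_cons p) = p.
  by case: p => x t; congr pair; exact/val_inj.
have mg : measurable_fun setT g.
  apply/measurable_fun_pairP; split; first exact: measurable_tnth.
  exact: measurable_behead.
exists (fun k => g @^-1` (F k `*` G k)).
  rewrite predeqE => t; split => // _.
  have [k _ Fk] : (\bigcup_i F i) (g t).1 by rewrite -TF.
  have [l _ Gl] : (\bigcup_i G i) (g t).2 by rewrite -TG.
  exists (maxn k l) => //; split.
  - by move: Fk; exact/subsetPset/ndF/leq_maxl.
  - by move: Gl; exact/subsetPset/ndG/leq_maxr.
move=> k; have [? ?] := Foo k; have [? ?] := Goo k; split.
  by rewrite -[X in measurable X]setTI; apply: mg => //; exact: measurableX.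
rewrite /cons_measure /pushforward -comp_preimage.
rewrite (_ : g \o tuple_cons = id) ?preimage_id; last exact/funext.
by rewrite product_measure1E// lte_mul_pinfty// ge0_fin_numE.
Qed.

HB.instance Definition _ :=
  Measure_isSigmaFinite.Build _ _ _ cons_measure cons_measure_sigma_finite.

End cons_measure.

(* Lebesgue measure on R^n, for n-tuples with their product sigma-algebra:    *)
(* the Dirac mass at the empty tuple for n = 0, and the image of the product  *)
(* of the one-dimensional and the n-dimensional ones under (x, t) |-> x :: t  *)
(* in dimension n + 1.                                                        *)
Fixpoint lebesgue_tuple (R : realType) (n : nat) :
    {sigma_finite_measure set (n.-tuple (measurableTypeR R)) -> \bar R} :=
  match n with
  | 0 => \d_[tuple]
  | n'.+1 => cons_measure lebesgue_measure (lebesgue_tuple R n')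
  end.

Section euclidean.
Context {R : realType} {n : nat}.
Implicit Types x y : 'rV[R]_n.

Definition dotp x y : R := \sum_(j < n) x 0 j * y 0 j.

(* The library norm `|x| on 'rV[R]_n is the maximum norm. *)
Definition enorm x : R := Num.sqrt (dotp x x).

Definition integral_rV (f : 'rV[R]_n -> R) : R :=
  \int[lebesgue_tuple R n]_(t in setT) f (\row_(i < n) tnth t i).

Definition integralC (f : 'rV[R]_n -> R[i]) : R[i] :=
  (integral_rV (fun x => complex.Re (f x))
   +i* integral_rV (fun x => complex.Im (f x)))%C.

Definition expi (t : R) : R[i] := (cos t +i* sin t)%C.

End euclidean.

Section schwartz.
Context {R : realType} {n : nat}.
Implicit Types (f : 'rV[R]_n -> R) (phi psi : 'rV[R]_n -> R[i]).

(* A multi-index is given as a word in the coordinates, e.g. [:: i; j; j] for *)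
(* d/dx_i (d/dx_j)^2.                                                         *)
Definition partial (s : seq 'I_n) f : 'rV[R]_n -> R :=
  foldr (fun j g x => 'D_(delta_mx 0 j) g x) f s.

Definition partialC (s : seq 'I_n) phi : 'rV[R]_n -> R[i] := fun x =>
  (partial s (fun y => complex.Re (phi y)) x
   +i* partial s (fun y => complex.Im (phi y)) x)%C.

Definition smooth f : Prop := forall s : seq 'I_n,
  continuous (partial s f) /\
  (forall (j : 'I_n) x, derivable (partial s f) x (delta_mx 0 j)).

Definition seminorm (k : nat) (s : seq 'I_n) phi : \bar R :=
  ereal_sup (range (fun x : 'rV[R]_n =>
    ((1 + enorm x) ^+ k * ComplexField.Normc.normc (partialC s phi x))%:E)).

Definition schwartz phi : Prop :=
  [/\ smooth (fun x => complex.Re (phi x)),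
      smooth (fun x => complex.Im (phi x)) &
      forall k s, (seminorm k s phi < +oo)%E].

(* Neighbourhoods of phi in the locally convex topology of S(R^n) defined by  *)
(* the seminorms above.                                                       *)
Definition schwartz_nbhs phi : set_system ('rV[R]_n -> R[i]) :=
  filter_from [set p : nat * R | 0 < p.2] (fun p => [set psi | schwartz psi /\
    forall k s, (k <= p.1)%N -> (size s <= p.1)%N ->
      (seminorm k s (fun x => psi x - phi x)%R < p.2%:E)%E]).

End schwartz.

(* Functionals are functions of arbitrary maps 'rV[R]_n -> R[i], of which     *)
(* only the values on schwartz are ever constrained; two functionals that     *)
(* agree on schwartz stand for the same element of S'(R^n).                   *)
Section tempered.
Context {R : realType} {n : nat}.
Local Notation functional := (('rV[R]_n -> R[i]) -> R[i]).
Implicit Types (T U : functional) (phi psi g : 'rV[R]_n -> R[i]).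

Definition tempered T : Prop :=
  (forall (a : R[i]) phi psi, schwartz phi -> schwartz psi ->
     T (fun x => a * phi x + psi x) = a * T phi + T psi) /\
  (forall phi, schwartz phi ->
     (T : ('rV[R]_n -> R[i]) -> R[i]^o) @ schwartz_nbhs phi
       --> (T phi : R[i]^o)).

(* Unconditional (net of finite partial sums) convergence of a series of      *)
(* tempered distributions in the weak topology of S'(R^n).                    *)
Definition sums_to (I : choiceType) (u : I -> functional) T : Prop :=
  [/\ forall k, tempered (u k), tempered T &
      forall phi, schwartz phi ->
        partial_sum (fun k => u k phi : R[i]^o) @ totally --> (T phi : R[i]^o)].

Definition regular g : functional := fun phi => integralC (fun x => g x * phi x).

Definition dirac_dist (a : 'rV[R]_n) : functional := fun phi => phi a.

Definition exp_dist (a : 'rV[R]_n) : functional :=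
  regular (fun x => expi (dotp a x)).

Definition fourier_cst : R[i] := ((2 * pi) `^ (- (n%:R / 2)))%:C%C.

Definition fourier phi : 'rV[R]_n -> R[i] := fun xi =>
  fourier_cst * integralC (fun x => expi (- dotp x xi) * phi x).

Definition fourier_inv phi : 'rV[R]_n -> R[i] := fun xi =>
  fourier_cst * integralC (fun x => expi (dotp x xi) * phi x).

Definition fourier_dist T : functional := fun phi => T (fourier phi).

Definition fourier_inv_dist T : functional := fun phi => T (fourier_inv phi).

Definition mul_dist g T : functional := fun phi => T (fun x => g x * phi x).

Definition cutoff (phi0 : 'rV[R]_n -> R[i]) : Prop :=
  [/\ schwartz phi0,
      forall x, enorm x <= 1 -> phi0 x = 1 &
      forall x, 3 / 2 <= enorm x -> phi0 x = 0].

Definition dyadic (phi0 : 'rV[R]_n -> R[i]) (k : nat) : 'rV[R]_n -> R[i] :=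
  match k with
  | 0 => phi0
  | k'.+1 => fun x => phi0 (2 ^- k *: x) - phi0 (2 ^- k' *: x)
  end.

(* The distribution (phi_j f^)^v has compactly supported Fourier transform;   *)
(* its value at x is that of the unique continuous function g j representing  *)
(* it.                                                                        *)
Definition zygmund (phi0 : 'rV[R]_n -> R[i]) (s : R) : set functional :=
  [set f | tempered f /\ exists g : nat -> 'rV[R]_n -> R[i],
    (forall j, continuous (g j : 'rV[R]_n -> R[i]^o) /\
       forall psi, schwartz psi ->
         fourier_inv_dist (mul_dist (dyadic phi0 j) (fourier_dist f)) psi =
         regular (g j) psi) /\
    (ereal_sup [set (2 `^ (j%:R * s) * ComplexField.Normc.normc (g j x))%:E
                | j in [set: nat] & x in [set: 'rV[R]_n]] < +oo)%E].

End tempered.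

(* Main.v *)
Require Import Defs.
From HB Require Import structures.
From mathcomp Require Import all_boot all_order all_algebra.
From mathcomp Require Import complex.
From mathcomp Require Import all_classical all_reals all_analysis.
From mathcomp Require Import measurable_realfun finmap ring lra zify.
Set Implicit Arguments.
Unset Strict Implicit.
Unset Printing Implicit Defensive.
Import Order.TTheory GRing.Theory Num.Theory.
Import numFieldNormedType.Exports.
Local Open Scope classical_set_scope.
Local Open Scope ring_scope.

(** The statement is Poisson's summation formula in weak form, together with a
    size estimate for the spectral pieces of the Dirac comb.

    The proof follows Fejer. The Cesaro means of the exponential sums
    sum_k e^(2 pi i k x / p) over cubes of Z^n are products of one-dimensional
    Fejer kernels. These are nonnegative, have mass p^n on every cell of the
    lattice p Z^n, and concentrate near the lattice points. Integrating such a
    kernel against a function f therefore tends to p^n sum_k f(p k), provided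
    that f decays like the product weight prod_j 1/(1 + x_j^2) and is Lipschitz
    with a constant of the same decay: this is [fejer_sampling], whose proof
    replaces f by its value at the nearest lattice point.

    Schwartz functions satisfy these two conditions. Their Fourier coefficients
    at the frequencies 2 pi k are bounded by the weight at k
    ([fourier_coef_decay]), because translating by half a period of a character
    changes its sign, so that the coefficients of phi are, up to a factor, those
    of its second differences. Hence the series of exponentials converges
    unconditionally; its sum is the limit of its Cesaro means ([cesaro_cvg]),
    which [fejer_sampling] with p = 1 identifies with sum_k phi(k). This is
    [poisson].

    The witness [comb] sends phi to the Cesaro limit of its values on Z^n. On
    functions with decay this is the unconditional sum. On a Fourier transform
    phi = h^ the Cesaro means of phi(k) are, up to a constant, integrals of h
    against Fejer kernels of period 2 pi, so [fejer_sampling] with p = 2 pi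
    evaluates [comb] there by sampling h itself on 2 pi Z^n. With h = phi_j psi^v,
    where psi^v is bounded and Lipschitz, this shows that (phi_j T^)^v is the
    trigonometric polynomial sum_k phi_j(2 pi k) e^(2 pi i k x). Only the k with
    |k_i| <= 2^j contribute, so it has at most (2^(j+1) + 1)^n terms with bounded
    coefficients, and is O(2^(j n)): this is membership in the Zygmund class of
    order -n. *)

(** * Integration over the recursively defined Lebesgue measure *)

Section measure.
Context {R : realType}.
Local Notation mR := (measurableTypeR R).

(** Tuples carry the measure and row vectors the topology; this map identifies
    the two. *)
Definition vec n (t : n.-tuple mR) : 'rV[R]_n := \row_(i < n) tnth t i.

(** The measure in dimension n + 1 is the image of a product measure, so Tonelli's
    theorem splits off the first coordinate. *)
Lemma ge0_integral_tuple_cons n (f : n.+1.-tuple mR -> \bar R) :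
  measurable_fun setT f -> (forall t, (0 <= f t)%E) ->
  (\int[lebesgue_tuple R n.+1]_t f t =
   \int[@lebesgue_measure R]_x \int[lebesgue_tuple R n]_t f (tuple_cons (x, t)))%E.
Proof.
move=> mf f0.
rewrite [LHS](ge0_integral_pushforward (@measurable_tuple_cons _ mR n))//.
rewrite preimage_setT (fubini_tonelli1 (f \o @tuple_cons _ mR n))//=.
by apply: measurableT_comp => //; exact: measurable_tuple_cons.
Qed.

Lemma integral_tuple_prod n (k : 'I_n -> R -> R) (c : 'I_n -> R) :
  (forall i, measurable_fun setT (k i)) -> (forall i x, 0 <= k i x) ->
  (forall i, \int[@lebesgue_measure R]_x (k i x)%:E = (c i)%:E)%E ->
  (\int[lebesgue_tuple R n]_t (\prod_i k i (tnth t i))%:E = (\prod_i c i)%:E)%E.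
Proof.
elim: n k c => [|n IH] k c mk k0 kc.
  rewrite [LHS]integral_dirac//.
    by rewrite diracT mul1e !big_ord0.
  under eq_fun do rewrite big_ord0; exact: measurable_cst.
have mp : measurable_fun setT
    (fun t : n.+1.-tuple mR => (\prod_i k i (tnth t i))%:E).
  apply/measurable_EFinP; apply: measurable_prod => i _.
  by apply: (measurableT_comp (mk i)); exact: measurable_tnth.
rewrite ge0_integral_tuple_cons//; last first.
  by move=> t; rewrite lee_fin; apply: prodr_ge0.
have c0 i : 0 <= c i.
  rewrite -lee_fin -kc; apply: integral_ge0 => x _; rewrite lee_fin; exact: k0.
have mp' : measurable_fun setT (fun t : n.-tuple mR =>
    (\prod_(i < n) k (lift ord0 i) (tnth t i))%:E).
  apply/measurable_EFinP; apply: measurable_prod => i _.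
  by apply: (measurableT_comp (mk _)); exact: measurable_tnth.
under eq_integral => x _.
  under eq_integral => t _.
    rewrite big_ord_recl /= [X in k ord0 X](_ : _ = x)//.
    under eq_bigr => i _ do rewrite [X in k _ X](_ : _ = tnth t i) ?tnthS//.
    rewrite EFinM.
    over.
  rewrite ge0_integralZl//; last 2 first.
  - by move=> t _; rewrite lee_fin; apply: prodr_ge0.
  - by rewrite lee_fin.
  rewrite (IH (fun i => k (lift ord0 i)) (fun i => c (lift ord0 i)))//.
  over.
rewrite ge0_integralZr//; last 3 first.
- by apply/measurable_EFinP; exact: mk.
- by move=> x _; rewrite lee_fin.
- by rewrite lee_fin; apply: prodr_ge0.
by rewrite kc -EFinM big_ord_recl.
Qed.

Lemma lebesgue_measure_shift (v : R) (A : set mR) : measurable A ->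
  pushforward lebesgue_measure ((fun x => x + v) : mR -> mR) A = lebesgue_measure A.
Proof.
move=> mA; apply/esym.
have mv : measurable_fun setT ((fun x => x + v) : mR -> mR).
  exact: measurable_funD.
apply: lebesgue_measure_unique => //= _ [[a b]] _ <-.
rewrite /pushforward [X in _ = lebesgue_measure X](_ : _ = `](a - v), (b - v)]%classic).
  by rewrite !lebesgue_measure_itv/= !lte_fin ltrD2r; case: ifP => // _;
    rewrite -!EFinD; congr EFin; ring.
by apply/seteqP; split => x /=; rewrite !in_itv /=; lra.
Qed.

Lemma ge0_integral_shift (v : R) (f : mR -> \bar R) :
  measurable_fun setT f -> (forall x, (0 <= f x)%E) ->
  (\int[@lebesgue_measure R]_x f (x + v)%R = \int[@lebesgue_measure R]_x f x)%E.
Proof.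
move=> mf f0.
have mv : measurable_fun setT ((fun x => x + v) : mR -> mR).
  exact: measurable_funD.
rewrite -[LHS](ge0_integral_pushforward mv lebesgue_measure measurableT mf)//.
by apply: eq_measure_integral => //= A mA _; exact: lebesgue_measure_shift.
Qed.

Definition tuple_shift n (v : 'I_n -> R) (t : n.-tuple mR) : n.-tuple mR :=
  [tuple tnth t i + v i | i < n].

Lemma measurable_tuple_shift n (v : 'I_n -> R) :
  measurable_fun setT (@tuple_shift n v).
Proof.
apply/measurable_fun_tnthP => i.
rewrite (_ : _ \o _ = fun t : n.-tuple mR => tnth t i + v i); last first.
  by apply/funext => t; rewrite /= tnth_mktuple.
apply: measurable_funD; last exact: measurable_cst.
exact: measurable_tnth.
Qed.

(** Induction on the dimension, from the invariance on the line. *)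
Lemma ge0_integral_tuple_shift n (v : 'I_n -> R) (f : n.-tuple mR -> \bar R) :
  measurable_fun setT f -> (forall x, (0 <= f x)%E) ->
  (\int[lebesgue_tuple R n]_t f (tuple_shift v t) = \int[lebesgue_tuple R n]_t f t)%E.
Proof.
elim: n v f => [|n IH] v f mf f0.
  by apply: eq_integral => t _; rewrite [tuple_shift _ _]tuple0 [t]tuple0.
have mfv : measurable_fun setT (f \o tuple_shift v).
  by apply: measurableT_comp => //; exact: measurable_tuple_shift.
rewrite !ge0_integral_tuple_cons//.
pose g x := (\int[lebesgue_tuple R n]_t f (tuple_cons (x, t)))%E.
have mg : measurable_fun (setT : set mR) g.
  have mfc : measurable_fun setT (f \o @tuple_cons _ mR n).
    by apply: measurableT_comp => //; exact: measurable_tuple_cons.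
  exact: (measurable_fun_fubini_tonelli_F (f \o @tuple_cons _ mR n) mfc (fun=> f0 _)).
have g0 x : (0 <= g x)%E by exact: integral_ge0.
rewrite -(ge0_integral_shift (v ord0) mg g0).
apply: eq_integral => x _; rewrite /g.
rewrite -(IH (fun i => v (lift ord0 i)) (fun t => f (tuple_cons (x + v ord0, t)))) => [|//|//].
  apply: eq_integral => t _; congr f; apply: eq_from_tnth => i.
  rewrite tnth_mktuple; case: (unliftP ord0 i) => [j ->|->].
    by rewrite !tnthS /= tnth_mktuple.
  by rewrite !tnth0.
apply: measurableT_comp => //.
exact: (measurable_cons (f := cst (x + v ord0)) (g := id)).
Qed.

End measure.

(** * Step functions on the cells of a lattice *)

Section cells.
Context {R : realType} {n : nat}.
Local Notation mR := (measurableTypeR R).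
Local Notation K := 'rV[int]_n.

Definition box_pt (M : nat) (f : {ffun 'I_n -> 'I_(M.*2.+1)}) : K :=
  \row_(i < n) ((f i)%:Z - M%:Z).

Definition box (M : nat) : {fset K} :=
  [fset box_pt f | f in {: {ffun 'I_n -> 'I_(M.*2.+1)}}]%fset.

Lemma in_box (M : nat) (k : K) : (k \in box M) = [forall i, `|k 0%R i|%N <= M]%N.
Proof.
apply/imfsetP/forallP => [[f _ ->] i|kM]; rewrite /=.
  by rewrite mxE; move: (nat_of_ord (f i)) (ltn_ord (f i)) => a aM; lia.
have kM' i : (`|(k 0%R i + M%:Z)%R| < M.*2.+1)%N by have := kM i; lia.
exists [ffun i => Ordinal (kM' i)] => //.
apply/rowP => i; rewrite mxE ffunE /=; have := kM i; lia.
Qed.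

Lemma sub_box (A : {fset K}) : exists M, (A `<=` box M)%fset.
Proof.
exists (\max_(k <- A) \max_(i < n) `|k 0%R i|%N)%N.
apply/fsubsetP => k kA; rewrite in_box; apply/forallP => i.
rewrite (leq_trans (@leq_bigmax _ (fun i => `|k 0%R i|%N) i))//.
exact: (@leq_bigmax_seq _ _ xpredT (fun k : K => (\max_(i < n) `|k 0%R i|)%N)).
Qed.

Lemma sum_fset_delta (S : {fset K}) (g : K -> R) (k : K) :
  \sum_(l <- S) g l * (k == l)%:R = if k \in S then g k else 0.
Proof.
case: ifPn => kS.
  rewrite (big_fsetD1 k)//= eqxx mulr1 big1_fset ?addr0// => l.
  by rewrite !inE => /andP[/negPf lk _] _; rewrite eq_sym lk mulr0.
rewrite big1_fset// => l lS _.
by case: eqP kS => [->|]; rewrite ?lS ?mulr0.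
Qed.

(** Index of the point of p Z nearest to x, the cells being the half-open intervals
    of length p centred at the points of p Z. *)
Definition nearest (p x : R) : int := Num.floor (x / p + 2^-1).

Definition nearestv (p : R) (x : 'rV[R]_n) : K := \row_i nearest p (x 0 i).

Definition lat (p : R) (k : K) : 'rV[R]_n := p *: map_mx intr k.

Lemma nearestP (p x : R) (m : int) : 0 < p ->
  (nearest p x == m) = (x \in `[p * (m%:~R - 2^-1), p * (m%:~R + 2^-1)[).
Proof.
move=> p0; rewrite floor_eq in_itv /= intrD.
have -> : x = p * (x / p) by rewrite mulrCA divff ?mulr1// gt_eqF.
rewrite ler_pM2l// ltr_pM2l// mulrCA divff ?mulr1 ?gt_eqF//.
by apply/idP/idP; lra.
Qed.

Lemma measurable_nearest (p : R) (m : int) : 0 < p ->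
  measurable_fun setT (fun x : mR => (nearest p x == m)%:R : R).
Proof.
move=> p0.
rewrite (_ : (fun _ => _) =
  \1_(`[p * (m%:~R - 2^-1), p * (m%:~R + 2^-1)[%classic : set mR)).
  by apply: measurable_indic; exact: measurable_itv.
by apply/funext => x; rewrite indicE nearestP// mem_setE.
Qed.

Lemma nearest_dist (p x : R) : 0 < p -> `|x - p * (nearest p x)%:~R| <= p / 2.
Proof.
move=> p0; have := nearestP x (nearest p x) p0; rewrite eqxx in_itv /=.
by move=> /esym /andP[]; rewrite ler_norml => ? ?; apply/andP; split; lra.
Qed.

Lemma nearestv_eq (p : R) (x : 'rV[R]_n) (k : K) :
  (nearestv p x == k)%:R = \prod_i (nearest p (x 0 i) == k 0 i)%:R :> R.
Proof.
case: eqP => [<-|/eqP].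
  by rewrite big1// => i _; rewrite mxE eqxx.
case: (pickP (fun i => nearest p (x 0 i) != k 0 i)) => [i ik _|h].
  by rewrite (bigD1 i)//= (negPf ik) mul0r.
move=> /eqP[]; apply/rowP => i; rewrite mxE.
by move/(_ i) : h => /negbT; rewrite negbK => /eqP.
Qed.

Lemma measurable_vec (i : 'I_n) (f : R -> R) :
  measurable_fun setT f ->
  measurable_fun setT (fun t : n.-tuple mR => f (vec t 0 i)).
Proof.
move=> mf; under eq_fun do rewrite mxE.
by apply: (measurableT_comp mf); exact: measurable_tnth.
Qed.

Lemma measurable_nearestv (p : R) (k : K) : 0 < p ->
  measurable_fun setT (fun t : n.-tuple mR => (nearestv p (vec t) == k)%:R : R).
Proof.
move=> p0; under eq_fun do rewrite nearestv_eq.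
apply: measurable_prod => i _; apply: (@measurable_vec i (fun y => (nearest p y == k 0 i)%:R)).
exact: measurable_nearest.
Qed.

Lemma measurable_step_box (p : R) (g : K -> R) (S : {fset K}) : 0 < p ->
  measurable_fun setT (fun t : n.-tuple mR =>
    \sum_(k <- S) g k * (nearestv p (vec t) == k)%:R).
Proof.
move=> p0; apply: measurable_sum => k.
apply: measurable_funM; first exact: measurable_cst.
exact: measurable_nearestv.
Qed.

Lemma box_eventually (k : K) : \forall M \near \oo, k \in box M.
Proof.
exists (\max_(i < n) `|k 0%R i|%N)%N => // M /= kM.
rewrite in_box; apply/forallP => i.
exact: leq_trans (@leq_bigmax _ (fun i => `|k 0%R i|%N) i) kM.
Qed.

(** The restrictions of g to larger and larger boxes are finite sums of indicator
    functions of products of intervals. *)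
Lemma measurable_step (p : R) (g : K -> R) : 0 < p ->
  measurable_fun setT (fun t : n.-tuple mR => g (nearestv p (vec t))).
Proof.
move=> p0; apply: measurable_fun_cvg => [M|t _].
  exact: (@measurable_step_box p g (box M)).
apply: cvg_near_cst; apply: filterS (box_eventually (nearestv p (vec t))).
by move=> M kM; rewrite sum_fset_delta kM.
Qed.

(** A continuous function is the limit of the step functions obtained by rounding
    its argument to finer and finer lattices. *)
Lemma measurable_continuous (f : 'rV[R]_n -> R) : continuous f ->
  measurable_fun setT (fun t : n.-tuple mR => f (vec t)).
Proof.
move=> cf; apply: (@measurable_fun_cvg _ _ _ _
  (fun m t => f (lat m.+1%:R^-1 (nearestv m.+1%:R^-1 (vec t))))) => [m|t _].
  by apply: (@measurable_step _ (f \o lat m.+1%:R^-1)); rewrite invr_gt0.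
apply: continuous_cvg; first exact: cf.
apply/cvg_ballP => e e0.
have /cvgrPdist_lt/(_ e e0) := @cvg_harmonic R; apply: filterS => m.
rewrite sub0r normrN ger0_norm ?harmonic_ge0// => me.
split=> // i j; rewrite ord1 /ball /= /lat !mxE.
apply: le_lt_trans (nearest_dist _ _) _; first by rewrite invr_gt0.
apply: le_lt_trans me; rewrite /harmonic /= ler_pdivrMr// ler_peMr//.
by rewrite ler1n.
Qed.

(** Densities that give the mass p to each cell of p Z. The constant 1 and the Fejer
    kernels of period p are both of this kind, so that the same estimates integrate
    step functions against products of the two. *)
Definition cell_kernel (p : R) (k : R -> R) :=
  [/\ measurable_fun setT k, forall x, 0 <= k x &
      forall m, (\int[@lebesgue_measure R]_x (k x * (nearest p x == m)%:R)%:E = p%:E)%E].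

Lemma integral_cell (p : R) (k : 'I_n -> R -> R) (l : K) : 0 < p ->
  (forall i, cell_kernel p (k i)) ->
  (\int[lebesgue_tuple R n]_t
    (\prod_i k i (vec t 0 i) * (nearestv p (vec t) == l)%:R)%:E = (p ^+ n)%:E)%E.
Proof.
move=> p0 kk.
transitivity (\prod_(i < n) p)%:E; last by rewrite prodr_const card_ord.
rewrite -(@integral_tuple_prod _ n (fun i x => k i x * (nearest p x == l 0 i)%:R))//.
- apply: eq_integral => t _; rewrite nearestv_eq -big_split /=; congr EFin.
  by apply: eq_bigr => i _; rewrite !mxE.
- by move=> i; have [mk _ _] := kk i; apply: measurable_funM => //; exact: measurable_nearest.
- by move=> i x; have [_ k0 _] := kk i; rewrite mulr_ge0.
- by move=> i; have [_ _ ->] := kk i.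
Qed.

Lemma measurable_kernel_prod (p : R) (k : 'I_n -> R -> R) :
  (forall i, cell_kernel p (k i)) ->
  measurable_fun setT (fun t : n.-tuple mR => \prod_i k i (vec t 0 i)).
Proof.
move=> kk; apply: measurable_prod => i _; apply: measurable_vec.
by have [] := kk i.
Qed.

Lemma integral_cell_sum (p : R) (k : 'I_n -> R -> R) (g : K -> R) (S : {fset K}) :
  0 < p -> (forall i, cell_kernel p (k i)) -> (forall l, 0 <= g l) ->
  (\int[lebesgue_tuple R n]_t
    (\prod_i k i (vec t 0 i) * \sum_(l <- S) g l * (nearestv p (vec t) == l)%:R)%:E
    = (p ^+ n * \sum_(l <- S) g l)%:E)%E.
Proof.
move=> p0 kk g0.
have kp0 t : 0 <= \prod_i k i (vec t 0 i).
  by apply: prodr_ge0 => i _; have [] := kk i.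
have mkl l : measurable_fun setT (fun t : n.-tuple mR =>
    (\prod_i k i (vec t 0 i) * (nearestv p (vec t) == l)%:R)%:E).
  apply/measurable_EFinP; apply: measurable_funM.
    exact: (measurable_kernel_prod kk).
  exact: measurable_nearestv.
have sumE t : (\prod_i k i (vec t 0 i) *
    \sum_(l <- S) g l * (nearestv p (vec t) == l)%:R)%:E =
    (\sum_(l <- S) (g l)%:E *
      (\prod_i k i (vec t 0 i) * (nearestv p (vec t) == l)%:R)%:E)%E.
  by rewrite mulr_sumr -sumEFin; apply: eq_bigr => l _; rewrite mulrCA.
under eq_integral => t _ do rewrite sumE.
rewrite ge0_integral_sum//; last 2 first.
- by move=> l; apply: emeasurable_funM => //; exact: measurable_cst.
- by move=> l t _; rewrite mule_ge0// lee_fin// mulr_ge0.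
rewrite mulr_sumr -sumEFin; apply: eq_bigr => l _.
rewrite ge0_integralZl//; last 2 first.
- by move=> t _; rewrite lee_fin mulr_ge0.
- by rewrite lee_fin.
by rewrite integral_cell// -EFinM mulrC.
Qed.

(** Monotone convergence along the boxes. *)
Lemma integral_step_le (p : R) (k : 'I_n -> R -> R) (g : K -> R) (S : R) :
  0 < p -> (forall i, cell_kernel p (k i)) -> (forall l, 0 <= g l) ->
  (forall B : {fset K}, \sum_(l <- B) g l <= S) ->
  (\int[lebesgue_tuple R n]_t
    (\prod_i k i (vec t 0 i) * g (nearestv p (vec t)))%:E <= (p ^+ n * S)%:E)%E.
Proof.
move=> p0 kk g0 gS.
have kp0 t : 0 <= \prod_i k i (vec t 0 i).
  by apply: prodr_ge0 => i _; have [] := kk i.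
pose G M t := (\prod_i k i (vec t 0 i) *
  \sum_(l <- box M) g l * (nearestv p (vec t) == l)%:R)%:E.
have mG M : measurable_fun setT (G M).
  apply/measurable_EFinP; apply: measurable_funM.
    exact: (measurable_kernel_prod kk).
  exact: measurable_step_box.
have G0 M t : setT t -> (0 <= G M t)%E.
  move=> _; rewrite lee_fin mulr_ge0//; apply: sumr_ge0 => l _.
  by rewrite mulr_ge0.
have ndG t : setT t -> {homo G^~ t : a b / (a <= b)%N >-> (a <= b)%E}.
  move=> _ a b ab; rewrite lee_fin ler_wpM2l// !sum_fset_delta.
  case: ifPn => ka; last by case: ifP.
  suff -> : nearestv p (vec t) \in box b by [].
  move: ka; rewrite !in_box => /forallP ka; apply/forallP => i.
  exact: leq_trans (ka i) ab.
have cG t : limn (G^~ t) = (\prod_i k i (vec t 0 i) * g (nearestv p (vec t)))%:E.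
  apply/cvg_lim => //; apply: cvg_near_cst.
  apply: filterS (box_eventually (nearestv p (vec t))).
  by move=> M kM; rewrite /G sum_fset_delta kM.
under eq_integral => t _ do rewrite -cG.
have := cvg_monotone_convergence (mu := lebesgue_tuple R n) measurableT mG G0 ndG.
move=> /cvg_lim <-//; apply: lime_le.
  apply/cvg_ex; eexists.
  exact: (cvg_monotone_convergence (mu := lebesgue_tuple R n) measurableT mG G0 ndG).
apply: nearW => M; rewrite /G integral_cell_sum// lee_fin ler_wpM2l//.
by rewrite exprn_ge0// ltW.
Qed.

End cells.

(** * Complex numbers *)

Section complex_norm.
Context {R : realType}.
Local Notation nm := (@ComplexField.Normc.normc R).
Implicit Types x y z : R[i].

Lemma ReD x y : complex.Re (x + y) = complex.Re x + complex.Re y.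
Proof. by case: x y => [? ?] []. Qed.

Lemma ImD x y : complex.Im (x + y) = complex.Im x + complex.Im y.
Proof. by case: x y => [? ?] []. Qed.

Lemma ReM x y : complex.Re (x * y) =
  complex.Re x * complex.Re y - complex.Im x * complex.Im y.
Proof. by case: x y => [? ?] []. Qed.

Lemma ImM x y : complex.Im (x * y) =
  complex.Re x * complex.Im y + complex.Im x * complex.Re y.
Proof. by case: x y => [? ?] [? ?]. Qed.

Lemma ReN x : complex.Re (- x) = - complex.Re x. Proof. by case: x. Qed.
Lemma ImN x : complex.Im (- x) = - complex.Im x. Proof. by case: x. Qed.

Lemma complex_eq x y : complex.Re x = complex.Re y ->
  complex.Im x = complex.Im y -> x = y.
Proof. by case: x y => [? ?] [? ?] /= -> ->. Qed.

Lemma normc_ge0 x : 0 <= nm x.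
Proof. by case: x => a b; exact: sqrtr_ge0. Qed.

Lemma normcD x y : nm (x + y) <= nm x + nm y.
Proof. exact: (@le_normcD R). Qed.

Lemma normc_opp x : nm (- x) = nm x.
Proof. exact: (@normcN R). Qed.

Lemma normcB x y : nm (x - y) <= nm x + nm y.
Proof. by rewrite -(normc_opp y) normcD. Qed.

Lemma normc_distC x y : nm (x - y) = nm (y - x).
Proof. by rewrite -normc_opp opprB. Qed.

Lemma normc_mul x y : nm (x * y) = nm x * nm y.
Proof. exact: ComplexField.Normc.normcM. Qed.

Lemma normc_real (a : R) : nm (a%:C)%C = `|a|.
Proof. by rewrite /= expr0n addr0 sqrtr_sqr. Qed.

Lemma Re_le_normc x : `|complex.Re x| <= nm x.
Proof.
case: x => a b /=; rewrite -sqrtr_sqr ler_wsqrtr// lerDl; exact: sqr_ge0.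
Qed.

Lemma Im_le_normc x : `|complex.Im x| <= nm x.
Proof.
case: x => a b /=; rewrite -sqrtr_sqr ler_wsqrtr// lerDr; exact: sqr_ge0.
Qed.

Lemma normc_le_ReIm x : nm x <= `|complex.Re x| + `|complex.Im x|.
Proof.
case: x => a b /=; rewrite -[leRHS]ger0_norm ?addr_ge0// -sqrtr_sqr.
apply: ler_wsqrtr; rewrite sqrrD !real_normK ?num_real//.
by rewrite -addrA lerD2l lerDr mulrn_wge0// mulr_ge0.
Qed.

Lemma normc_sum (I : Type) (s : seq I) (P : pred I) (F : I -> R[i]) :
  nm (\sum_(i <- s | P i) F i) <= \sum_(i <- s | P i) nm (F i).
Proof.
elim/big_rec2: _ => [|i a b _ ab]; first by rewrite ComplexField.Normc.normc0.
by rewrite (le_trans (normcD _ _))// lerD2l.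
Qed.

Lemma normc_expi (t : R) : nm (expi t) = 1.
Proof. by rewrite /expi /= cos2Dsin2 sqrtr1. Qed.

Lemma expiD (s t : R) : expi (s + t) = expi s * expi t.
Proof. by apply: complex_eq; rewrite /= ?cosD ?sinD// addrC (mulrC (cos s)). Qed.

Lemma expi0 : expi 0 = 1 :> R[i].
Proof. by rewrite /expi cos0 sin0. Qed.

Lemma expi_sum (I : Type) (s : seq I) (F : I -> R) :
  expi (\sum_(i <- s) F i) = \prod_(i <- s) expi (F i) :> R[i].
Proof. exact: (big_morph _ expiD expi0). Qed.

Lemma realcM (a b : R) : ((a * b)%:C = a%:C * b%:C)%C.
Proof. by apply: complex_eq; rewrite ?ReM ?ImM /= ?mul0r ?mulr0 ?subr0 ?addr0. Qed.

End complex_norm.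

(** * Integrals of complex functions *)

Section complex_integral.
Context {R : realType} {n : nat}.
Local Notation mR := (measurableTypeR R).
Local Notation nm := (@ComplexField.Normc.normc R).
Local Notation mu := (lebesgue_tuple R n).
Implicit Types (f g : 'rV[R]_n -> R[i]) (h : 'rV[R]_n -> R).

Definition rmeas h := measurable_fun setT (fun t : n.-tuple mR => h (vec t)).

Definition cmeas f :=
  rmeas (fun x => complex.Re (f x)) /\ rmeas (fun x => complex.Im (f x)).

Definition rintegrable h := mu.-integrable setT (EFin \o (fun t => h (vec t))).

Definition cintegrable f :=
  rintegrable (fun x => complex.Re (f x)) /\
  rintegrable (fun x => complex.Im (f x)).

Lemma cmeas_real h : rmeas h -> cmeas (fun x => (h x)%:C%C).
Proof. by move=> mh; split => //=; exact: measurable_cst. Qed.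

Lemma cmeas_cst (c : R[i]) : cmeas (fun=> c).
Proof. by split; exact: measurable_cst. Qed.

Lemma cmeasD f g : cmeas f -> cmeas g -> cmeas (fun x => f x + g x).
Proof.
move=> [f1 f2] [g1 g2]; split; rewrite /rmeas.
  by under eq_fun do rewrite ReD; exact: measurable_funD.
by under eq_fun do rewrite ImD; exact: measurable_funD.
Qed.

Lemma cmeasM f g : cmeas f -> cmeas g -> cmeas (fun x => f x * g x).
Proof.
move=> [f1 f2] [g1 g2]; split; rewrite /rmeas.
  under eq_fun do rewrite ReM.
  by apply: measurable_funB; exact: measurable_funM.
under eq_fun do rewrite ImM.
by apply: measurable_funD; exact: measurable_funM.
Qed.

Lemma cmeasB f g : cmeas f -> cmeas g -> cmeas (fun x => f x - g x).
Proof.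
move=> mf mg; rewrite (_ : (fun _ => _) = fun x => f x + (-1) * g x).
  by apply: cmeasD => //; apply: cmeasM => //; exact: cmeas_cst.
by apply/funext => x; rewrite mulN1r.
Qed.

Lemma cmeas_sum (I : Type) (s : seq I) (F : I -> 'rV[R]_n -> R[i]) :
  (forall i, cmeas (F i)) -> cmeas (fun x => \sum_(i <- s) F i x).
Proof.
move=> mF; elim: s => [|i s IH].
  by under eq_fun do rewrite big_nil; exact: cmeas_cst.
by under eq_fun do rewrite big_cons; exact: cmeasD.
Qed.

Lemma cmeas_continuous f : continuous (fun x => complex.Re (f x)) ->
  continuous (fun x => complex.Im (f x)) -> cmeas f.
Proof. by move=> ? ?; split; exact: measurable_continuous. Qed.

Lemma rmeas_dotp (a : 'rV[R]_n) : rmeas (dotp a).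
Proof.
apply: measurable_sum => j; apply: measurable_funM; first exact: measurable_cst.
exact: (@measurable_vec _ _ j id).
Qed.

Lemma cmeas_expi h : rmeas h -> cmeas (fun x => expi (h x)).
Proof.
move=> mh; split; apply: measurableT_comp mh.
  by apply: continuous_measurable_fun; exact: continuous_cos.
by apply: continuous_measurable_fun; exact: continuous_sin.
Qed.

Lemma rmeas_shift (v : 'rV[R]_n) h : rmeas h -> rmeas (fun x => h (x + v)).
Proof.
move=> mh; have := measurableT_comp mh (@measurable_tuple_shift R n (fun i => v 0 i)).
congr measurable_fun; apply/funext => t /=; congr h.
by apply/rowP => i; rewrite !mxE tnth_mktuple.
Qed.

Lemma cmeas_shift (v : 'rV[R]_n) f : cmeas f -> cmeas (fun x => f (x + v)).
Proof.
by move=> [f1 f2]; split; [exact: rmeas_shift f1|exact: rmeas_shift f2].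
Qed.

Lemma integralC_shift (v : 'rV[R]_n) f : cmeas f ->
  integralC (fun x => f (x + v)) = integralC f.
Proof.
move=> [f1 f2].
suff E h : rmeas h -> integral_rV (fun x => h (x + v)) = integral_rV h.
  by rewrite /integralC (E (fun x => complex.Re (f x)))//
    (E (fun x => complex.Im (f x))).
move=> mh.
have tE t : vec (tuple_shift (fun i => v 0 i) t) = vec t + v.
  by apply/rowP => i; rewrite !mxE tnth_mktuple.
have mE : measurable_fun setT (EFin \o (fun t : n.-tuple mR => h (vec t))).
  exact/measurable_EFinP.
rewrite /integral_rV /Rintegral; congr fine.
rewrite [LHS]integralE [RHS]integralE; congr (_ - _)%E.
  rewrite -[RHS](ge0_integral_tuple_shift (fun i => v 0 i))//.
    by apply: eq_integral => t _; rewrite !funeposE /= -[\row_i tnth t i]/(vec t) -tE.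
  exact: measurable_funepos.
rewrite -[RHS](ge0_integral_tuple_shift (fun i => v 0 i))//.
  by apply: eq_integral => t _; rewrite !funenegE /= -[\row_i tnth t i]/(vec t) -tE.
exact: measurable_funeneg.
Qed.

Lemma rintegrable_le h1 h S : rmeas h1 -> rmeas h ->
  (forall x, `|h1 x| <= h x) -> (\int[mu]_t (h (vec t))%:E <= S%:E)%E ->
  rintegrable h1 /\ `|integral_rV h1| <= S.
Proof.
move=> m1 mh le_h hS.
have ii : rintegrable h1.
  apply/integrableP; split; first exact/measurable_EFinP.
  apply: (@le_lt_trans _ _ S%:E); last exact: ltry.
  apply: le_trans hS; apply: ge0_le_integral => //.
  - by apply: measurableT_comp => //; exact/measurable_EFinP.
  - exact/measurable_EFinP.
  - by move=> t _; rewrite lee_fin.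
split => //; rewrite /integral_rV (le_trans (le_normr_Rintegral _ ii))//.
rewrite -lee_fin /Rintegral fineK.
  apply: le_trans hS; apply: ge0_le_integral => //.
  - by apply/measurable_EFinP; exact: measurableT_comp.
  - exact/measurable_EFinP.
  - by move=> t _; rewrite lee_fin.
by apply: integrable_fin_num => //; exact: (integrable_norm ii).
Qed.

(** The factor 2 comes from estimating the real and imaginary parts separately. *)
Lemma integralC_le f h S : cmeas f -> rmeas h ->
  (forall x, nm (f x) <= h x) -> (\int[mu]_t (h (vec t))%:E <= S%:E)%E ->
  cintegrable f /\ nm (integralC f) <= 2 * S.
Proof.
move=> [f1 f2] mh fh hS.
have [i1 b1] : rintegrable (fun x => complex.Re (f x)) /\
    `|integral_rV (fun x => complex.Re (f x))| <= S.
  by apply: rintegrable_le hS => // x; exact: le_trans (Re_le_normc _) (fh x).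
have [i2 b2] : rintegrable (fun x => complex.Im (f x)) /\
    `|integral_rV (fun x => complex.Im (f x))| <= S.
  by apply: rintegrable_le hS => // x; exact: le_trans (Im_le_normc _) (fh x).
split => //; rewrite (le_trans (normc_le_ReIm _))//=.
by rewrite mulrDl mul1r lerD.
Qed.

Lemma cintegrableD f g : cintegrable f -> cintegrable g ->
  cintegrable (fun x => f x + g x).
Proof.
move=> [f1 f2] [g1 g2]; split; rewrite /rintegrable.
  rewrite (_ : _ \o _ = (EFin \o (fun t => complex.Re (f (vec t)))) \+
                        (EFin \o (fun t => complex.Re (g (vec t)))))%E.
    exact: integrableD.
  by apply/funext => t /=; rewrite ReD.
rewrite (_ : _ \o _ = (EFin \o (fun t => complex.Im (f (vec t)))) \+
                      (EFin \o (fun t => complex.Im (g (vec t)))))%E.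
  exact: integrableD.
by apply/funext => t /=; rewrite ImD.
Qed.

Lemma integralCD f g : cintegrable f -> cintegrable g ->
  integralC (fun x => f x + g x) = integralC f + integralC g.
Proof.
move=> [f1 f2] [g1 g2]; apply: complex_eq => /=; rewrite /integral_rV -RintegralD//;
  by apply: eq_Rintegral => t _; rewrite ?ReD ?ImD.
Qed.

Lemma rintegrable_lin (a b : R) h1 h2 : rintegrable h1 -> rintegrable h2 ->
  rintegrable (fun x => a * h1 x + b * h2 x) /\
  integral_rV (fun x => a * h1 x + b * h2 x) =
    a * integral_rV h1 + b * integral_rV h2.
Proof.
move=> i1 i2.
have j1 : rintegrable (fun x => a * h1 x).
  exact: (integrableZl measurableT a i1).
have j2 : rintegrable (fun x => b * h2 x).
  exact: (integrableZl measurableT b i2).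
split; first exact: (integrableD measurableT j1 j2).
rewrite /integral_rV RintegralD//; congr (_ + _); exact: RintegralZl.
Qed.

Lemma cintegrableZ (c : R[i]) f : cintegrable f ->
  cintegrable (fun x => c * f x) /\ integralC (fun x => c * f x) = c * integralC f.
Proof.
move=> [f1 f2]; case: c => a b.
have [i1 e1] := rintegrable_lin a (- b) f1 f2.
have [i2 e2] := rintegrable_lin a b f2 f1.
have E1 : (fun x => complex.Re ((a +i* b)%C * f x)) =
    fun x => a * complex.Re (f x) + - b * complex.Im (f x).
  by apply/funext => x; rewrite ReM mulNr.
have E2 : (fun x => complex.Im ((a +i* b)%C * f x)) =
    fun x => a * complex.Im (f x) + b * complex.Re (f x).
  by apply/funext => x; rewrite ImM.
split; first by split; rewrite ?E1 ?E2.
by apply: complex_eq; rewrite /= ?E1 ?E2 ?e1 ?e2 ?mulNr.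
Qed.

Lemma cintegrable_sum (I : Type) (s : seq I) (F : I -> 'rV[R]_n -> R[i]) :
  (forall i, cintegrable (F i)) ->
  cintegrable (fun x => \sum_(i <- s) F i x) /\
  integralC (fun x => \sum_(i <- s) F i x) = \sum_(i <- s) integralC (F i).
Proof.
move=> iF; elim: s => [|i s [IH1 IH2]].
  have e0 : (fun x : 'rV[R]_n => \sum_(i <- [::]) F i x) = fun=> 0.
    by apply/funext => x; rewrite big_nil.
  rewrite e0 big_nil; split.
    by split; exact: integrable0.
  apply: complex_eq; rewrite /= /integral_rV /Rintegral;
  by rewrite (eq_integral (cst 0%E)) ?integral0.
have e0 : (fun x : 'rV[R]_n => \sum_(j <- i :: s) F j x) =
    fun x => F i x + \sum_(j <- s) F j x.
  by apply/funext => x; rewrite big_cons.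
rewrite e0 big_cons -IH2; split; first exact: cintegrableD.
exact: integralCD.
Qed.

Lemma cintegrableB f g : cintegrable f -> cintegrable g ->
  cintegrable (fun x => f x - g x) /\
  integralC (fun x => f x - g x) = integralC f - integralC g.
Proof.
move=> i1 i2; have [j2 e2] := cintegrableZ (-1) i2.
have -> : (fun x => f x - g x) = fun x => f x + (-1) * g x.
  by apply/funext => x; rewrite mulN1r.
by split; [exact: cintegrableD|rewrite integralCD// e2 mulN1r].
Qed.

End complex_integral.

(** * The Fejer kernel on the line *)

Section fejer.
Context {R : realType}.
Local Notation nm := (@ComplexField.Normc.normc R).

Lemma sin_addz (x : R) (d : int) : sin (x + 2 * pi * d%:~R) = sin x.
Proof.
have e (y : R) (k : nat) : sin (y + 2 * pi * k%:R) = sin y.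
  have <- : y + (pi *+ 2) *+ k = y + 2 * pi * k%:R.
    by rewrite -(mulr_natr _ k) -(mulr_natr pi 2); ring.
  exact: (periodicn (@sinD2pi R)).
case: d => k; first exact: e.
rewrite -[LHS](e _ k.+1) NegzE mulrNz -pmulrn mulrN subrK.
by [].
Qed.

Lemma cos_addz (x : R) (d : int) : cos (x + 2 * pi * d%:~R) = cos x.
Proof.
have e (y : R) (k : nat) : cos (y + 2 * pi * k%:R) = cos y.
  have <- : y + (pi *+ 2) *+ k = y + 2 * pi * k%:R.
    by rewrite -(mulr_natr _ k) -(mulr_natr pi 2); ring.
  exact: (periodicn (@cosD2pi R)).
case: d => k; first exact: e.
rewrite -[LHS](e _ k.+1) NegzE mulrNz -pmulrn mulrN subrK.
by [].
Qed.

Definition dirichlet (N : nat) (th : R) : R[i] := \sum_(a < N.+1) expi (a%:R * th).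

Definition fejer (p : R) (N : nat) (x : R) : R :=
  N.+1%:R^-1 * nm (dirichlet N (2 * pi * x / p)) ^+ 2.

Lemma fejer_ge0 p N x : 0 <= fejer p N x.
Proof. by rewrite mulr_ge0 ?invr_ge0// exprn_ge0// normc_ge0. Qed.

Lemma normc2 (z : R[i]) : nm z ^+ 2 = complex.Re z ^+ 2 + complex.Im z ^+ 2.
Proof. by case: z => a b /=; rewrite sqr_sqrtr// addr_ge0// sqr_ge0. Qed.

Lemma Re_sum (I : Type) (s : seq I) (F : I -> R[i]) :
  complex.Re (\sum_(i <- s) F i) = \sum_(i <- s) complex.Re (F i).
Proof. by apply: (big_morph _ (@ReD R)). Qed.

Lemma Im_sum (I : Type) (s : seq I) (F : I -> R[i]) :
  complex.Im (\sum_(i <- s) F i) = \sum_(i <- s) complex.Im (F i).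
Proof. by apply: (big_morph _ (@ImD R)). Qed.

Lemma dirichlet_sqr N th : \sum_(a < N.+1) \sum_(b < N.+1) expi ((a%:R - b%:R) * th)
  = ((nm (dirichlet N th) ^+ 2)%:C)%C.
Proof.
have cE z : ((nm z ^+ 2)%:C)%C = z * (complex.Re z -i* complex.Im z)%C.
  by rewrite normc2; case: z => a b; apply: complex_eq; rewrite ?ReM ?ImM /=; ring.
rewrite cE.
have -> : (complex.Re (dirichlet N th) -i* complex.Im (dirichlet N th))%C =
    \sum_(b < N.+1) expi (- (b%:R * th)).
  apply: complex_eq; rewrite /dirichlet /=.
    by rewrite !Re_sum; apply: eq_bigr => b _; rewrite /= cosN.
  by rewrite !Im_sum -sumrN; apply: eq_bigr => b _; rewrite /= sinN.
have -> : dirichlet N th = \sum_(a < N.+1) expi (a%:R * th) by [].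
rewrite mulr_suml; apply: eq_bigr => a _; rewrite mulr_sumr; apply: eq_bigr => b _.
by rewrite -expiD; congr expi; ring.
Qed.

Lemma fejer_cos p N x : fejer p N x = N.+1%:R^-1 *
  \sum_(a < N.+1) \sum_(b < N.+1) cos ((a%:R - b%:R) * (2 * pi * x / p)).
Proof.
rewrite /fejer; congr (_ * _).
have /(congr1 (@complex.Re R)) /= <- := dirichlet_sqr N (2 * pi * x / p).
by rewrite Re_sum; apply: eq_bigr => a _; rewrite Re_sum.
Qed.

(** Antiderivative of x |-> cos (c x); the case c = 0 serves the diagonal terms of the
    double sum in [fejer_cos]. *)
Definition cos_prim (c x : R) : R := if c == 0 then x else c^-1 * sin (c * x).

Lemma is_derive_cos_prim (c x : R) : is_derive x 1 (cos_prim c) (cos (c * x)).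
Proof.
rewrite /cos_prim; case: eqVneq => [->|c0].
  by rewrite mul0r cos0; exact: is_derive_id.
have d1 : is_derive x 1 (fun y : R => c * y) (c * 1).
  exact: (@is_deriveZ _ _ _ id c x 1 1).
have d2 := @is_derive1_comp _ (@sin R) _ x _ _ (is_derive_sin (c * x)) d1.
have := @is_deriveZ _ _ _ _ c^-1 _ _ _ d2.
by rewrite mulr1 /GRing.scale /= mulrCA mulVf// mulr1.
Qed.

Lemma cos_prim_period (p x : R) (d : int) : 0 < p ->
  cos_prim (d%:~R * (2 * pi / p)) (x + p) - cos_prim (d%:~R * (2 * pi / p)) x
  = if d == 0 then p else 0.
Proof.
move=> p0; have pip : 2 * pi / p != 0 :> R.
  by rewrite gt_eqF// divr_gt0// mulr_gt0// pi_gt0.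
rewrite /cos_prim mulf_eq0 (negPf pip) orbF intr_eq0; case: eqVneq => [_|d0].
  by rewrite addrC addKr.
have -> : d%:~R * (2 * pi / p) * (x + p) =
    d%:~R * (2 * pi / p) * x + 2 * pi * d%:~R by field; rewrite gt_eqF.
by rewrite sin_addz subrr.
Qed.

Lemma continuous_fejer p N : continuous (fejer p N).
Proof.
move=> x.
have -> : fejer p N = fun x => N.+1%:R^-1 *
    \sum_(a < N.+1) \sum_(b < N.+1) cos ((a%:R - b%:R) * (2 * pi * x / p)).
  by apply/funext => y; exact: fejer_cos.
apply: cvgMr; apply: cvg_big => [|a _]; first exact: add_continuous.
apply: cvg_big => [|b _]; first exact: add_continuous.
apply: continuous_comp; last exact: continuous_cos.
apply: cvgMr; apply: cvgMl; apply: cvgMr; exact: cvg_id.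
Qed.

Lemma fejer_cell_kernel p N : 0 < p -> cell_kernel p (fejer p N).
Proof.
move=> p0; split.
- by apply: continuous_measurable_fun; exact: continuous_fejer.
- exact: fejer_ge0.
move=> m.
pose a0 := p * (m%:~R - 2^-1); pose b0 := p * (m%:~R + 2^-1).
have ba : b0 = a0 + p by rewrite /a0 /b0; field.
have ab : a0 < b0 by rewrite ba ltrDl.
transitivity (\int[@lebesgue_measure R]_(x in `[a0, b0[) (fejer p N x)%:E)%E.
  rewrite [RHS]integral_mkcond; apply: eq_integral => x _.
  rewrite patchE nearestP// mem_setE.
  by case: ifP; rewrite ?mulr1 ?mulr0.
rewrite (@integral_itv_bndoo _ a0 b0 _ true true)
  -?(@integral_itv_bndoo _ a0 b0 _ true false); last 2 first.
- apply: measurable_funTS; apply/measurable_EFinP.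
  by apply: continuous_measurable_fun; exact: continuous_fejer.
- apply: measurable_funTS; apply/measurable_EFinP.
  by apply: continuous_measurable_fun; exact: continuous_fejer.
pose c (a b : 'I_N.+1) : R := (a%:Z - b%:Z)%:~R * (2 * pi / p).
pose F : R -> R := N.+1%:R^-1 \*: \sum_(a < N.+1) \sum_(b < N.+1) cos_prim (c a b).
have dF (x : R) : is_derive x 1 F (fejer p N x).
  rewrite fejer_cos; apply: is_deriveZ.
  apply: is_derive_sum => a; apply: is_derive_sum => b.
  have -> : (a%:R - b%:R) * (2 * pi * x / p) = c a b * x.
    by rewrite /c intrB !pmulrn; field; rewrite gt_eqF.
  exact: is_derive_cos_prim.
have cF : continuous F.
  move=> x; apply: differentiable_continuous; apply/derivable1_diffP.
  by have [] := dF x.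
rewrite (@continuous_FTC2 _ _ F)//; last 3 first.
- by apply: continuous_subspaceT; exact: continuous_fejer.
- split.
  + by move=> x _; have [] := dF x.
  + by apply: cvg_at_right_filter; exact: cF.
  + by apply: cvg_at_left_filter; exact: cF.
- by move=> x _; rewrite derive1E; have [_ ->] := dF x.
rewrite -EFinB; congr EFin.
have FE x : F x = N.+1%:R^-1 * \sum_(a < N.+1) \sum_(b < N.+1) cos_prim (c a b) x.
  rewrite /F /= /GRing.scale /= fct_sumE; congr (_ * _); apply: eq_bigr => a _.
  by rewrite fct_sumE.
rewrite !FE -mulrBr -sumrB.
under eq_bigr => a _.
  rewrite -sumrB.
  under eq_bigr => b _ do rewrite ba cos_prim_period//.
  rewrite (bigD1 a)//= subrr eqxx big1 ?addr0; last first.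
    move=> b ba'; case: eqP => // e.
    by case/eqP: ba'; apply/val_inj => /=; lia.
  over.
by rewrite sumr_const card_ord -(mulr_natr p) mulrCA mulVf ?mulr1// pnatr_eq0.
Qed.

(** The geometric sum is multiplied by 1 - e^(i th), whose squared modulus is
    2 - 2 cos th. *)
Lemma dirichlet_le N th : nm (dirichlet N th) ^+ 2 * (1 - cos th) <= 2.
Proof.
have tele : (1 - expi th) * dirichlet N th = 1 - expi (N.+1%:R * th).
  rewrite /dirichlet; elim: N => [|N IH].
    by rewrite big_ord1 mul0r expi0 mulr1 mul1r.
  rewrite big_ord_recr /= mulrDr IH mulrBl mul1r -expiD.
  rewrite addrA subrK; congr (_ - expi _).
  by rewrite -[in RHS]natr1; ring.
have nE t : nm (1 - expi t) ^+ 2 = 2 - 2 * cos t.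
  by rewrite normc2 /= -(cos2Dsin2 t); have := cos2Dsin2 t; nra.
have : nm (dirichlet N th) ^+ 2 * (2 - 2 * cos th) <= 4.
  rewrite -nE -exprMn -normc_mul mulrC tele nE.
  by have := cos_geN1 (N.+1%:R * th); lra.
by lra.
Qed.

(** Near the lattice the distance is small; away from it the kernel is O(1/N), as
    cos (2 pi x / p) stays away from 1. Either way the product is controlled,
    uniformly in x. *)
Lemma fejer_concentrates (p e : R) : 0 < p -> 0 < e ->
  exists N0, forall N x, (N0 <= N)%N ->
    fejer p N x * `|x - p * (nearest p x)%:~R| <= e * fejer p N x + e.
Proof.
move=> p0 e0.
have pi0 := @pi_gt0 R.
pose d := 2 * pi * e / p.
have d0 : 0 < d by rewrite divr_gt0// !mulr_gt0.
pose C := p / (e * (1 - cos d)).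
exists (Num.trunc `|C|).+1 => N x NN.
have F0 := fejer_ge0 p N x.
have [|le_e] := leP `|x - p * (nearest p x)%:~R| e.
  by move=> le_e; rewrite (mulrC e) (le_trans (ler_wpM2l F0 le_e))// lerDl ltW.
set y := x - p * (nearest p x)%:~R in le_e *.
have y2 : `|y| <= p / 2 by exact: nearest_dist.
pose t := 2 * pi * `|y| / p.
have ct : cos (2 * pi * x / p) = cos t.
  have -> : 2 * pi * x / p = 2 * pi * y / p + 2 * pi * (nearest p x)%:~R.
    by rewrite /y; field; rewrite gt_eqF.
  rewrite cos_addz /t; case: (ger0P y) => _ //.
  by rewrite mulrN mulNr cosN.
have tpi : t <= pi.
  by rewrite /t ler_pdivrMr//; nra.
have dt : d < t by rewrite /d /t ltr_pM2r ?invr_gt0// ltr_pM2l// mulr_gt0.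
have cdt : cos t < cos d by rewrite ltr_cos// in_itv /=; apply/andP; split; lra.
have cd1 : cos d < 1 by rewrite -cos0 ltr_cos// in_itv /= ?lexx ?ltW//; lra.
have D2 := dirichlet_le N (2 * pi * x / p); rewrite ct in D2.
have N0 : 0 < N.+1%:R :> R by [].
have D0 : 0 <= nm (dirichlet N (2 * pi * x / p)) ^+ 2 by rewrite exprn_ge0// normc_ge0.
have FD : fejer p N x * (1 - cos d) <= 2 / N.+1%:R.
  rewrite /fejer; move: (nm _ ^+ 2) D2 D0 => D D2 D0.
  rewrite -mulrA [leRHS]mulrC ler_pM2l ?invr_gt0//.
  by apply: le_trans D2; rewrite ler_wpM2l//; lra.
have CN : C <= N.+1%:R.
  apply: le_trans (ler_norm _) _; apply: ltW; apply: (lt_le_trans (truncnS_gt _)).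
  by rewrite ler_nat ltnW.
suff : fejer p N x * `|y| <= e.
  by move=> /le_trans; apply; rewrite lerDr mulr_ge0// ltW.
apply: (@le_trans _ _ (fejer p N x * (p / 2))); first exact: ler_wpM2l.
have cd0 : 0 < 1 - cos d by lra.
rewrite -(ler_pM2r cd0) mulrAC.
apply: le_trans (ler_wpM2r _ FD) _; first by rewrite divr_ge0// ltW.
have -> : 2 / N.+1%:R * (p / 2) = p / N.+1%:R by field; rewrite gt_eqF.
rewrite ler_pdivrMr//.
move: CN; rewrite /C ler_pdivrMr ?mulr_gt0//; nra.
Qed.

End fejer.

(** * Unconditional sums *)

Section unconditional_sums.
Context {R : realType} {I : choiceType}.
Local Notation nm := (@ComplexField.Normc.normc R).

(** Convergence of the net of finite partial sums, with a real rather than a complex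
    tolerance. *)
Definition has_sum (u : I -> R[i]) (s : R[i]) := forall e : R, 0 < e ->
  exists A : {fset I}, forall B : {fset I}, (A `<=` B)%fset ->
    nm (\sum_(i <- B) u i - s) <= e.

Lemma sum_fsetD_le (A B : {fset I}) (b : I -> R) (v : I -> R[i]) (C : R) :
  (forall i, nm (v i) <= C * b i) -> (A `<=` B)%fset ->
  nm (\sum_(i <- B) v i - \sum_(i <- A) v i) <=
    C * (\sum_(i <- B) b i - \sum_(i <- A) b i).
Proof.
move=> vb AB.
have E (V : zmodType) (w : I -> V) : \sum_(i <- B) w i - \sum_(i <- A) w i =
    \sum_(i <- [fset i in B | i \notin A]%fset) w i.
  rewrite (@big_fsetID _ _ _ _ (mem A) B)/=.
  have -> : [fset x in B | x \in A]%fset = A.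
    apply/fsetP => i; rewrite !inE /= andbC.
    by case iA: (i \in A) => //=; rewrite (fsubsetP AB).
  by rewrite addrAC subrr add0r.
by rewrite !E (le_trans (normc_sum _ _ _))// mulr_sumr ler_sum.
Qed.

Lemma sum_fset_le (A B : {fset I}) (b : I -> R) :
  (forall i, 0 <= b i) -> (A `<=` B)%fset ->
  \sum_(i <- A) b i <= \sum_(i <- B) b i.
Proof.
move=> b0 AB.
have bb i : nm ((b i)%:C)%C <= 1 * b i by rewrite normc_real mul1r ger0_norm.
have := sum_fsetD_le bb AB; rewrite mul1r => h.
by rewrite -subr_ge0; apply: le_trans h; exact: normc_ge0.
Qed.

Section dominated.
Context (b : I -> R) (S : R) (b0 : forall i, 0 <= b i)
  (bS : forall B : {fset I}, \sum_(i <- B) b i <= S).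

(** The set A nearly attains the supremum of the finite sums. *)
Lemma sum_tail (e : R) : 0 < e -> exists A : {fset I}, forall B : {fset I},
  (A `<=` B)%fset -> \sum_(i <- B) b i - \sum_(i <- A) b i <= e.
Proof.
move=> e0; pose E := range (fun B : {fset I} => \sum_(i <- B) b i).
have uE : has_ubound E by exists S => _ [B _ <-].
have sE : has_sup E by split => //; exists (\sum_(i <- fset0) b i); exists fset0.
have [_ [A _ <-] lt_A] := sup_adherent e0 sE.
exists A => B _; rewrite lerBlDr.
have : \sum_(i <- B) b i <= sup E by apply: ub_le_sup => //; exists B.
lra.
Qed.

Lemma has_sum_le (u : I -> R[i]) (s : R[i]) (C : R) :
  (forall i, nm (u i) <= C * b i) -> 0 <= C -> has_sum u s -> nm s <= C * S.
Proof.
move=> uC C0 us; apply/ler_addgt0Pr => e e0.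
have [A /(_ A (fsubset_refl _)) hA] := us _ e0.
rewrite -[s](subKr (\sum_(i <- A) u i)).
apply: (le_trans (normcB _ _)); rewrite lerD//.
apply: (le_trans (normc_sum _ _ _)).
by apply: le_trans (ler_wpM2l C0 (bS A)); rewrite mulr_sumr ler_sum.
Qed.

(** The net of partial sums is Cauchy by [sum_tail]. *)
Lemma real_has_sum (v : I -> R) (C : R) : 0 <= C ->
  (forall i, `|v i| <= C * b i) ->
  exists s : R, forall e : R, 0 < e -> exists A : {fset I}, forall B : {fset I},
    (A `<=` B)%fset -> `|\sum_(i <- B) v i - s| <= e.
Proof.
move=> C0 vC.
have vD (A B : {fset I}) : (A `<=` B)%fset ->
    `|\sum_(i <- B) v i - \sum_(i <- A) v i| <=
      C * (\sum_(i <- B) b i - \sum_(i <- A) b i).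
  move=> AB.
  have vC' i : nm ((v i)%:C)%C <= C * b i by rewrite normc_real.
  have := sum_fsetD_le vC' AB.
  by rewrite -!(rmorph_sum (real_complex R)) -rmorphB normc_real.
pose F := (fun B : {fset I} => \sum_(i <- B) v i) @ totally.
have cF : cvg F.
  apply: (@cauchy_cvg _ F (fmap_proper_filter _ totally_filter)).
  have FT : ProperFilter (@totally I) by exact: totally_filter.
  apply/(@cauchy_exP R R F (fmap_filter _ _)) => e e0.
  have eC : 0 < e / (2 * (C + 1)) by rewrite divr_gt0// mulr_gt0// ltr_wpDl.
  have [A hA] := sum_tail eC.
  exists (\sum_(i <- A) v i); exists A => // B AB; rewrite /ball /= distrC.
  apply: (le_lt_trans (vD _ _ AB)); have := hA B AB.
  rewrite ler_pdivlMr ?mulr_gt0 ?ltr_wpDl//.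
  have : 0 <= \sum_(i <- B) b i - \sum_(i <- A) b i.
    by rewrite subr_ge0 sum_fset_le.
  nra.
exists (lim F) => e e0.
have FT : ProperFilter (@totally I) by exact: totally_filter.
move/cvgrPdist_le : cF => /(_ e e0) [A _ hA].
by exists A => B AB; rewrite distrC; exact: hA.
Qed.

Lemma dominated_has_sum (u : I -> R[i]) (C : R) : 0 <= C ->
  (forall i, nm (u i) <= C * b i) -> exists s, has_sum u s.
Proof.
move=> C0 uC.
have [|r hr] := real_has_sum C0 (v := fun i => complex.Re (u i)).
  by move=> i; exact: le_trans (Re_le_normc _) (uC i).
have [|m hm] := real_has_sum C0 (v := fun i => complex.Im (u i)).
  by move=> i; exact: le_trans (Im_le_normc _) (uC i).
exists (r +i* m)%C => e e0.
have e2 : 0 < e / 2 by lra.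
have [A hA] := hr _ e2; have [A' hA'] := hm _ e2.
exists (A `|` A')%fset => B; rewrite fsubUset => /andP[/hA h1 /hA' h2].
apply: (le_trans (normc_le_ReIm _)); rewrite [leRHS]splitr.
by rewrite ReD ImD ReN ImN Re_sum Im_sum /= lerD.
Qed.

End dominated.

Lemma has_sum_fin (A : {fset I}) (u : I -> R[i]) :
  (forall i, i \notin A -> u i = 0) -> has_sum u (\sum_(i <- A) u i).
Proof.
move=> u0 e e0; exists A => B AB.
rewrite -(big_fset_incl _ AB) ?subrr ?ComplexField.Normc.normc0 ?ltW//.
by move=> i _; exact: u0.
Qed.

End unconditional_sums.

(** * The weight, and Cesaro means over Z^n *)

Section lattice_sums.
Context {R : realType} {n : nat}.
Local Notation nm := (@ComplexField.Normc.normc R).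
Local Notation K := 'rV[int]_n.

(** The product form reduces sums over Z^n and integrals over R^n to dimension one,
    while (1 + |x|)^(-2n) still lies below this weight ([weight_enorm] below). *)
Definition weight (x : 'rV[R]_n) : R := \prod_(j < n) (1 + x 0 j ^+ 2)^-1.

Lemma weight_gt0 x : 0 < weight x.
Proof.
by apply: prodr_gt0 => j _; rewrite invr_gt0 ltr_pwDl// sqr_ge0.
Qed.

Lemma weight_ge0 x : 0 <= weight x. Proof. exact/ltW/weight_gt0. Qed.

Lemma weight_le1 x : weight x <= 1.
Proof.
apply: prodr_ile1 => j _; rewrite invr_ge0 invf_le1 ?ltr_pwDl ?sqr_ge0//.
by rewrite lerDl sqr_ge0 addr_ge0// sqr_ge0.
Qed.

Lemma weight_le_prod (c : R) (x y : 'rV[R]_n) : 0 <= c ->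
  (forall j, 1 + y 0 j ^+ 2 <= c * (1 + x 0 j ^+ 2)) -> weight x <= c ^+ n * weight y.
Proof.
move=> c0 h; rewrite /weight -[n in c ^+ n]card_ord -prodr_const -big_split /=.
apply: ler_prod => j _; rewrite invr_ge0 addr_ge0 ?sqr_ge0//=.
by rewrite ler_pdivlMr ?ltr_pwDl ?sqr_ge0// mulrC ler_pdivrMr ?ltr_pwDl ?sqr_ge0.
Qed.

(** The weight varies slowly, as in Peetre's inequality. *)
Lemma weight_near (r : R) (x y : 'rV[R]_n) : 0 <= r ->
  (forall j, `|x 0 j - y 0 j| <= r) -> weight x <= (2 + 2 * r ^+ 2) ^+ n * weight y.
Proof.
move=> r0 xy; apply: weight_le_prod => [|j].
  by rewrite addr_ge0// mulr_ge0// sqr_ge0.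
have := xy j; rewrite ler_norml => /andP[h1 h2].
set a := x 0 j in h1 h2 *; set b := y 0 j in h1 h2 *.
have d2 : (b - a) ^+ 2 <= r ^+ 2 by nra.
have : 0 <= (b - 2 * a) ^+ 2 by exact: sqr_ge0.
have : 0 <= a ^+ 2 * r ^+ 2 by rewrite mulr_ge0// sqr_ge0.
nra.
Qed.

Lemma weight_scale (p : R) (x : 'rV[R]_n) : 0 < p ->
  weight (p *: x) <= (1 + p ^- 2) ^+ n * weight x.
Proof.
move=> p0; apply: weight_le_prod => [|j].
  by rewrite addr_ge0// invr_ge0 sqr_ge0.
rewrite mxE exprMn; set b := x 0 j.
have -> : (1 + p ^- 2) * (1 + p ^+ 2 * b ^+ 2) =
   1 + b ^+ 2 + (p ^- 2 + p ^+ 2 * b ^+ 2) by field; rewrite gt_eqF.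
rewrite lerDl; apply: addr_ge0; first by rewrite invr_ge0 sqr_ge0.
by apply: mulr_ge0; exact: sqr_ge0.
Qed.

(** The two terms of index +m and -m add up to 2 / (1 + m^2), which is at most
    4 / m - 4 / (m + 1); the bounds telescope. *)
Lemma inv_sqr_sum (M : nat) :
  \sum_(a < M.*2.+1) (1 + (a%:R - M%:R) ^+ 2)^-1 <= 5 - 4 / M.+1%:R :> R.
Proof.
elim: M => [|M IH].
  by rewrite big_ord1 subr0 expr0n addr0; lra.
rewrite doubleS big_ord_recl big_ord_recr /=.
have -> : \sum_(i < M.*2.+1) (1 + ((bump 0 i)%:R - M.+1%:R) ^+ 2)^-1 =
          \sum_(a < M.*2.+1) (1 + (a%:R - M%:R) ^+ 2)^-1 :> R.
  by apply: eq_bigr => i _; rewrite /bump leq0n add1n -!natr1; congr (_^-1); ring.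
have -> : bump 0 M.*2.+1 = (M.*2.+2)%N by [].
have -> : (M.*2.+2)%:R - M.+1%:R = M.+1%:R :> R.
  by rewrite -doubleS -addnn natrD addrK.
rewrite sub0r sqrrN.
have m0 : 0 < M.+1%:R :> R by [].
have e : M.+2%:R = M.+1%:R + 1 :> R by rewrite natr1.
have key : 2 / (1 + M.+1%:R ^+ 2) <= 4 / M.+1%:R - 4 / M.+2%:R :> R.
  rewrite e; move: (M.+1%:R : R) m0 => m m0.
  have -> : 4 / m - 4 / (m + 1) = 4 / (m * (m + 1)).
    by field; rewrite !gt_eqF//; lra.
  rewrite ler_pdivrMr; last by nra.
  rewrite mulrAC ler_pdivlMr; last by nra.
  nra.
move: key IH; move: (\sum_(a < _) _) (4 / M.+1%:R) (4 / M.+2%:R) => X Y Z.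
by move: ((1 + M.+1%:R ^+ 2)^-1) => V; lra.
Qed.

Lemma box_pt_inj M : injective (@box_pt n M).
Proof.
move=> f g fg; apply/ffunP => i; apply/val_inj => /=.
by move/rowP/(_ i) : fg; rewrite !mxE; lia.
Qed.

Lemma sum_box (V : nmodType) (M : nat) (F : K -> V) :
  \sum_(k <- @box n M) F k = \sum_(f : {ffun 'I_n -> 'I_(M.*2.+1)}) F (box_pt f).
Proof.
rewrite big_imfset /=; last by move=> f g _ _; exact: box_pt_inj.
by rewrite big_enum.
Qed.

Lemma weight_lat_sum (p : R) : 0 < p ->
  exists S, 0 <= S /\ forall B : {fset K}, \sum_(k <- B) weight (lat p k) <= S.
Proof.
move=> p0; exists ((1 + p ^- 2) ^+ n * 5 ^+ n).
have c0 : 0 <= 1 + p ^- 2 by rewrite addr_ge0// invr_ge0 sqr_ge0.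
split; first by rewrite mulr_ge0 ?exprn_ge0.
move=> B; have [M BM] := sub_box B.
apply: (@le_trans _ _ (\sum_(k <- @box n M) weight (lat p k))).
  by apply: sum_fset_le => // k; exact: weight_ge0.
apply: (@le_trans _ _ ((1 + p ^- 2) ^+ n * \sum_(k <- @box n M) weight (map_mx intr k))).
  by rewrite mulr_sumr ler_sum// => k _; exact: weight_scale.
rewrite ler_wpM2l ?exprn_ge0// sum_box.
have -> : \sum_(f : {ffun 'I_n -> 'I_M.*2.+1}) weight (map_mx intr (box_pt f)) =
   \prod_(i < n) \sum_(a < M.*2.+1) (1 + (a%:R - M%:R) ^+ 2)^-1.
  rewrite bigA_distr_bigA; apply: eq_bigr => f _; apply: eq_bigr => i _.
  by rewrite !mxE intrB.
rewrite prodr_const card_ord lerXn2r ?nnegrE//.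
  by apply: sumr_ge0 => a _; rewrite invr_ge0 addr_ge0// sqr_ge0.
apply: le_trans (inv_sqr_sum M) _; rewrite gerBl divr_ge0//.
Qed.

Definition diff_pt (N : nat) (b a : {ffun 'I_n -> 'I_N.+1}) : K :=
  \row_i ((a i)%:Z - (b i)%:Z).

Lemma diff_pt_inj N (b : {ffun 'I_n -> 'I_N.+1}) : injective (diff_pt b).
Proof.
move=> f g fg; apply/ffunP => i; apply/val_inj => /=.
by move/rowP/(_ i) : fg; rewrite !mxE; lia.
Qed.

(** Cesaro means over cubes, written as averages over the differences a - b of two
    points of the cube: this form turns exponential sums into squared moduli. *)
Definition cesaro_mean (N : nat) (u : K -> R[i]) : R[i] :=
  ((N.+1%:R ^- n)%:C)%C * \sum_(a : {ffun 'I_n -> 'I_N.+1})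
    \sum_(b : {ffun 'I_n -> 'I_N.+1}) u (diff_pt b a).

Definition inner (M N c : nat) : bool := (M <= c <= N - M)%N.

Lemma inner_sum (M N : nat) : (M <= N)%N ->
  1 - 2 * M%:R / N.+1%:R <= N.+1%:R^-1 * \sum_(c < N.+1) (inner M N c)%:R :> R.
Proof.
move=> MN.
have lo k m : \sum_(c < k) (c < m)%N%:R <= m%:R :> R.
  have -> : \sum_(c < k) (c < m)%N%:R = (minn k m)%:R :> R.
    elim: k => [|k IH]; first by rewrite big_ord0 min0n.
    by rewrite big_ord_recr /= IH -natrD; congr _%:R; lia.
  by rewrite ler_nat geq_minr.
have hi : \sum_(c < N.+1) (N - c < M)%N%:R <= M%:R :> R.
  rewrite (reindex_inj rev_ord_inj) /=; apply: le_trans (lo N.+1 M).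
  apply: ler_sum => c _; rewrite ler_nat; have := ltn_ord c; lia.
have : \sum_(c < N.+1) 1 <= \sum_(c < N.+1) (inner M N c)%:R
    + \sum_(c < N.+1) (c < M)%N%:R + \sum_(c < N.+1) (N - c < M)%N%:R :> R.
  rewrite -!big_split /=; apply: ler_sum => c _; rewrite -!natrD ler1n /inner.
  have := ltn_ord c; lia.
rewrite sumr_const card_ord => h.
have := lo N.+1 M; move: hi h; set u := \sum_(c < N.+1) (inner M N c)%:R.
move=> h1 h2 h3; have N0 : 0 < N.+1%:R :> R by [].
rewrite -(ler_pM2l N0) mulrA divff ?gt_eqF// mul1r mulrBr mulr1 mulrCA divff ?gt_eqF//.
lra.
Qed.

(** For fixed b the differences a - b run over a translated cube. A given finite set
    lies in this cube for all b except a fraction that tends to 0, and for the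
    exceptional b the partial sums are bounded. *)
Lemma cesaro_cvg (u : K -> R[i]) (s : R[i]) (D : R) : has_sum u s ->
  (forall B : {fset K}, nm (\sum_(k <- B) u k) <= D) ->
  forall e : R, 0 < e -> exists N0, forall N, (N0 <= N)%N -> nm (cesaro_mean N u - s) <= e.
Proof.
move=> us uD e e0.
have e2 : 0 < e / 2 by lra.
have [A hA] := us _ e2; have [M AM] := sub_box A.
have sD : nm s <= D + e / 2.
  rewrite -[s](subKr (\sum_(k <- A) u k)).
  by apply: (le_trans (normcB _ _)); rewrite lerD// hA.
pose D' := D + (D + e / 2).
have D'0 : 0 <= D'.
  by rewrite addr_ge0 ?(le_trans (normc_ge0 _) sD) ?(le_trans (normc_ge0 _) (uD fset0)).
have : (fun N => D' * (1 - (1 - 2 * M%:R / N.+1%:R) ^+ n)) @ \oo -->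
    (D' * (1 - (1 - 2 * M%:R * 0) ^+ n) : R).
  apply: cvgMr; apply: cvgB; first exact: cvg_cst.
  apply: (@continuous_cvg _ R R _ _ (fun N => 1 - 2 * M%:R / N.+1%:R)
    (fun y => y ^+ n) _ (@exprn_continuous _ _ _)).
  apply: cvgB; first exact: cvg_cst.
  by apply: cvgMr; exact: cvg_harmonic.
rewrite mulr0 subr0 expr1n subrr mulr0 => /cvgrPdist_le/(_ _ e2)[N1 _ hN1].
exists (maxn N1 M.*2) => N; rewrite geq_max => /andP[/hN1 hN MN].
rewrite /= sub0r normrN in hN.
pose Sb (b : {ffun 'I_n -> 'I_N.+1}) := \sum_(a : {ffun 'I_n -> 'I_N.+1})
   u (diff_pt b a).
(* good b is 1 when every coordinate of b is far enough from the faces of the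
   cube for the translated cube to contain the box of size M *)
pose good (b : {ffun 'I_n -> 'I_N.+1}) : R := \prod_i (inner M N (b i))%:R.
have SbE b : Sb b = \sum_(k <- [fset diff_pt b a |
    a in {: {ffun 'I_n -> 'I_N.+1}}]%fset) u k.
  by rewrite big_imfset /= ?big_enum// => f g _ _; exact: diff_pt_inj.
have goodP b : nm (Sb b - s) <= e / 2 + D' * (1 - good b).
  have [all_in|] := boolP [forall i, inner M N (b i)].
    rewrite /good big1 ?subrr ?mulr0 ?addr0; last first.
      by move=> i _; rewrite (forallP all_in i).
    rewrite SbE; apply: hA; apply: fsubset_trans AM _.
    apply/fsubsetP => k; rewrite in_box => /forallP kM.
    have aP i : (`|(k 0%R i + (b i)%:Z)%R| < N.+1)%N.
      have := kM i; have := forallP all_in i; rewrite /inner.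
      move: (nat_of_ord (b i)) (k 0%R i : int) => c z; lia.
    apply/imfsetP; exists [ffun i => Ordinal (aP i)] => //=.
    apply/rowP => i; rewrite mxE ffunE /=.
    have := kM i; have := forallP all_in i; rewrite /inner.
    move: (nat_of_ord (b i)) (k 0%R i : int) => c z; lia.
  rewrite negb_forall => /existsP[i bi].
  rewrite /good (bigD1 i)//= (negPf bi) mul0r subr0 mulr1.
  apply: (le_trans (normcB _ _)).
  apply: (@le_trans _ _ D'); last by rewrite lerDr ltW.
  by rewrite SbE lerD.
have N0 : 0 < N.+1%:R :> R by [].
have Nn0 : 0 < N.+1%:R ^- n :> R by rewrite invr_gt0 exprn_gt0.
have NnE : N.+1%:R ^- n * #|{ffun 'I_n -> 'I_N.+1}|%:R = 1 :> R.
  by rewrite card_ffun !card_ord natrX mulVf// expf_neq0// gt_eqF.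
have cNnE : ((N.+1%:R ^- n)%:C)%C * #|{ffun 'I_n -> 'I_N.+1}|%:R = 1 :> R[i].
  by rewrite -(rmorph_nat (real_complex R)) -(rmorphM (real_complex R)) NnE.
have -> : cesaro_mean N u - s = ((N.+1%:R ^- n)%:C)%C *
    \sum_(b : {ffun 'I_n -> 'I_N.+1}) (Sb b - s).
  rewrite /cesaro_mean exchange_big /= sumrB mulrBr; congr (_ - _).
  rewrite sumr_const -(mulr_natl s) mulrA.
  by rewrite cNnE mul1r.
rewrite normc_mul normc_real (ger0_norm (ltW Nn0)).
apply: (@le_trans _ _ (N.+1%:R ^- n *
   \sum_(b : {ffun 'I_n -> 'I_N.+1}) (e / 2 + D' * (1 - good b)))).
  rewrite ler_pM2l//; apply: (le_trans (normc_sum _ _ _)).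
  by apply: ler_sum => b _; exact: goodP.
rewrite big_split /= sumr_const -mulr_sumr sumrB sumr_const mulrDr.
rewrite -(mulr_natr (e / 2)) mulrCA NnE mulr1 mulrCA mulrBr NnE.
rewrite [leRHS](splitr e) lerD2l.
apply: le_trans hN; apply: le_trans (ler_norm _); rewrite ler_wpM2l// lerD2l lerN2.
have -> : \sum_(b : {ffun 'I_n -> 'I_N.+1}) good b =
    \prod_(i < n) \sum_(c < N.+1) (inner M N c)%:R.
  by rewrite bigA_distr_bigA.
rewrite prodr_const card_ord -exprVn -exprMn lerXn2r ?nnegrE//.
- rewrite subr_ge0 ler_pdivrMr// mul1r -natrM ler_nat; lia.
- by rewrite mulr_ge0 ?invr_ge0// sumr_ge0.
- by apply: inner_sum; lia.
Qed.

End lattice_sums.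

(** * Sampling by Fejer kernels *)

Section sampling.
Context {R : realType} {n : nat}.
Local Notation nm := (@ComplexField.Normc.normc R).
Local Notation K := 'rV[int]_n.
Local Notation mu := (lebesgue_tuple R n).
Implicit Types (f : 'rV[R]_n -> R[i]) (h : 'rV[R]_n -> R).

Definition decay (C : R) f := forall x, nm (f x) <= C * weight x.

(** The weight is taken at y only, since it is comparable at points of bounded
    distance; the constant may depend on the bound r. *)
Definition weighted_lip f := forall r : R, 0 <= r -> exists C, 0 <= C /\
  forall x y : 'rV[R]_n, (forall j, `|x 0 j - y 0 j| <= r) ->
    nm (f x - f y) <= C * (\sum_j `|x 0 j - y 0 j|) * weight y.

(** Majorants are handled through their extended integral, which makes sense before
    integrability is known. *)
Definition integral_bound h (S : R) := [/\ rmeas h, forall x, 0 <= h x &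
  (\int[mu]_t (h (vec t))%:E <= S%:E)%E].

Lemma integral_boundD h1 h2 S1 S2 : integral_bound h1 S1 -> integral_bound h2 S2 ->
  integral_bound (fun x => h1 x + h2 x) (S1 + S2).
Proof.
move=> [m1 p1 i1] [m2 p2 i2]; split.
- exact: measurable_funD.
- by move=> x; rewrite addr_ge0.
- under eq_integral => t _ do rewrite EFinD.
  rewrite ge0_integralD//.
  + by rewrite EFinD leeD.
  + by move=> t _; rewrite lee_fin.
  + exact/measurable_EFinP.
  + by move=> t _; rewrite lee_fin.
  + exact/measurable_EFinP.
Qed.

Lemma integral_bound_sum (I : Type) (s : seq I) (h : I -> 'rV[R]_n -> R) (S : I -> R) :
  (forall i, integral_bound (h i) (S i)) ->
  integral_bound (fun x => \sum_(i <- s) h i x) (\sum_(i <- s) S i).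
Proof.
move=> hS; elim: s => [|i s IH].
  rewrite big_nil; split.
  - by rewrite /rmeas; under eq_fun do rewrite big_nil; exact: measurable_cst.
  - by move=> x; rewrite big_nil.
  - by under eq_integral do rewrite big_nil; rewrite integral0.
rewrite big_cons; rewrite [X in integral_bound X](_ : _ =
  fun x => h i x + \sum_(j <- s) h j x); first exact: integral_boundD.
by apply/funext => x; rewrite big_cons.
Qed.

Lemma integral_bound_step (p : R) (k : 'I_n -> R -> R) (g : K -> R) (S : R) :
  0 < p -> (forall i, cell_kernel p (k i)) -> (forall l, 0 <= g l) ->
  (forall B : {fset K}, \sum_(l <- B) g l <= S) ->
  integral_bound (fun x => \prod_i k i (x 0 i) * g (nearestv p x)) (p ^+ n * S).
Proof.
move=> p0 kk g0 gS; split.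
- apply: measurable_funM; first exact: (measurable_kernel_prod kk).
  exact: measurable_step.
- move=> x; apply: mulr_ge0 => //; apply: prodr_ge0 => i _.
  by have [_ k0 _] := kk i.
- exact: integral_step_le.
Qed.

Lemma one_cell_kernel (p : R) : 0 < p -> cell_kernel p (fun=> 1).
Proof.
move=> p0; split => // m.
pose a : R := p * (m%:~R - 2^-1); pose b : R := p * (m%:~R + 2^-1).
transitivity (\int[@lebesgue_measure R]_(x in `[a, b[) (cst 1%E x))%E.
  rewrite [RHS]integral_mkcond; apply: eq_integral => x _.
  by rewrite patchE nearestP// mem_setE mul1r; case: ifP.
rewrite integral_cst//= mul1e lebesgue_measure_itv /= lte_fin.
rewrite /a /b ltr_pM2l// ltrD2l; case: ltP => [_|h]; last by exfalso; lra.
by rewrite -EFinB; congr (_%:E); field.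
Qed.

Lemma weight_nearest (p : R) (x : 'rV[R]_n) : 0 < p ->
  weight x <= (2 + 2 * (p / 2) ^+ 2) ^+ n * weight (lat p (nearestv p x)).
Proof.
move=> p0; apply: weight_near => [|j]; first by rewrite divr_ge0// ltW.
by rewrite !mxE; exact: nearest_dist.
Qed.

(** The weight is dominated by a step function on the unit cells, whose integral is a
    multiple of the convergent sum of the weight over Z^n. *)
Lemma weight_integral_bound : exists IW, integral_bound (@weight R n) IW.
Proof.
have [S [S0 hS]] := @weight_lat_sum R n 1 ltr01.
pose c : R := (2 + 2 * (1 / 2) ^+ 2) ^+ n.
have c0 : 0 <= c by rewrite exprn_ge0// addr_ge0// mulr_ge0// sqr_ge0.
have mW : rmeas (@weight R n).
  apply: measurable_prod => j _.
  apply: (@measurable_vec _ _ j (fun y => (1 + y ^+ 2)^-1)).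
  apply: continuous_measurable_fun => y.
  apply: cvgV; first by rewrite gt_eqF// ltr_pwDl// sqr_ge0.
  by apply: cvgD; [exact: cvg_cst|exact: exprn_continuous].
have [||m1 p1 i1] := @integral_bound_step 1 (fun _ _ => 1) (fun l => c * weight (lat 1 l)) (c * S)
    ltr01 (fun _ => one_cell_kernel ltr01).
- by move=> l; rewrite mulr_ge0// weight_ge0.
- by move=> B; rewrite -mulr_sumr ler_wpM2l.
exists (1 ^+ n * (c * S)); split => //; first by move=> x; exact: weight_ge0.
apply: le_trans i1; apply: ge0_le_integral => //.
- by move=> t _; rewrite lee_fin weight_ge0.
- exact/measurable_EFinP.
- exact/measurable_EFinP.
- by move=> t _; rewrite lee_fin big1// mul1r weight_nearest.
Qed.

Definition fejer_kernel (p : R) (N : nat) (x : 'rV[R]_n) : R := \prod_j fejer p N (x 0 j).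

Lemma kernel_ge0 p N x : 0 <= fejer_kernel p N x.
Proof. by apply: prodr_ge0 => j _; exact: fejer_ge0. Qed.

Lemma rmeas_kernel p N : 0 < p -> rmeas (fejer_kernel p N).
Proof.
by move=> p0; exact: (measurable_kernel_prod (fun _ => fejer_cell_kernel N p0)).
Qed.

Lemma integralC_kernel_cell p N (l : K) : 0 < p ->
  cintegrable (fun x => ((fejer_kernel p N x * (nearestv p x == l)%:R)%:C)%C) /\
  integralC (fun x => ((fejer_kernel p N x * (nearestv p x == l)%:R)%:C)%C) = ((p ^+ n)%:C)%C.
Proof.
move=> p0; have E := integral_cell l p0 (fun _ => fejer_cell_kernel N p0).
have m1 : rmeas (fun x => fejer_kernel p N x * (nearestv p x == l)%:R).
  by apply: measurable_funM; [exact: rmeas_kernel|exact: measurable_nearestv].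
have nb x : nm ((fejer_kernel p N x * (nearestv p x == l)%:R)%:C)%C <=
    fejer_kernel p N x * (nearestv p x == l)%:R.
  by rewrite normc_real ger0_norm// mulr_ge0// kernel_ge0.
have hE : (\int[mu]_t (fejer_kernel p N (vec t) * (nearestv p (vec t) == l)%:R)%:E <=
  (p ^+ n)%:E)%E by rewrite E.
have [ci _] := integralC_le (cmeas_real m1) m1 nb hE.
split => //; apply: complex_eq => /=; rewrite /integral_rV /Rintegral.
  by rewrite [X in fine X]E.
by rewrite integral0.
Qed.

Lemma kernel_conc p (e : R) : 0 < p -> 0 < e -> exists N0, forall N x j, (N0 <= N)%N ->
  fejer_kernel p N x * `|x 0 j - p * (nearestv p x 0 j)%:~R| <=
  e * fejer_kernel p N x + e * \prod_i (if i == j then 1 else fejer p N (x 0 i)).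
Proof.
move=> p0 e0; have [N0 hN] := fejer_concentrates p0 e0.
exists N0 => N x j NN; have := hN N (x 0 j) NN.
rewrite [nearestv p x 0 j]mxE.
pose P := \prod_(i < n | i != j) fejer p N (x 0 i).
have P0 : 0 <= P by apply: prodr_ge0 => i _; exact: fejer_ge0.
have -> : fejer_kernel p N x = fejer p N (x 0 j) * P by rewrite /fejer_kernel (bigD1 j).
have -> : \prod_i (if i == j then 1 else fejer p N (x 0 i)) = P.
  rewrite (bigD1 j)//= eqxx mul1r; apply: eq_bigr => i /negPf ij.
  by rewrite ij.
by move=> h; have := ler_wpM2r P0 h; lra.
Qed.

(** The function f is replaced by its value at the nearest lattice point, outside a
    finite set A of lattice points by 0. This step function integrates exactly, as
    the kernel has mass p^n on each cell. The error is at most the weighted Lipschitz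
    constant times the distance to the lattice, which the kernel makes small by
    [kernel_conc], plus the tail of the weight outside A. *)
Theorem fejer_sampling (p C : R) f (s : R[i]) : 0 < p -> 0 <= C ->
  cmeas f -> decay C f -> weighted_lip f -> has_sum (fun k => f (lat p k)) s ->
  forall e : R, 0 < e -> exists N0, forall N, (N0 <= N)%N ->
    nm (integralC (fun x => ((fejer_kernel p N x)%:C)%C * f x) - ((p ^+ n)%:C)%C * s) <= e.
Proof.
move=> p0 C0 mf fC fL fs e e0.
have [S [S0 hS]] := @weight_lat_sum R n p p0.
have p2 : 0 <= p / 2 by rewrite divr_ge0// ltW.
have [L [L0 hL]] := fL _ p2.
have pn0 : 0 <= p ^+ n by rewrite exprn_ge0// ltW.
(* T collects the constants that multiply the tolerance d in the final estimate *)
pose T : R := 2 * (n%:R * (p ^+ n * (L * S) + p ^+ n * (L * S)) + p ^+ n * C) + p ^+ n.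
have T0 : 0 <= T by rewrite !(addr_ge0, mulr_ge0).
pose d := e / (T + 1).
have d0 : 0 < d by rewrite divr_gt0// ltr_wpDl.
have [A1 hA1] := fs _ d0.
have [A2 hA2] := sum_tail hS d0.
pose A := (A1 `|` A2)%fset.
have [N0 hN0] := kernel_conc p0 d0.
exists N0 => N NN.
pose fA x := \sum_(l <- A) f (lat p l) * (((nearestv p x == l)%:R : R)%:C)%C.
have fAE x : fA x = if nearestv p x \in A then f (lat p (nearestv p x)) else 0.
  rewrite /fA; case: ifPn => kA.
    rewrite (big_fsetD1 (nearestv p x))//= eqxx mulr1 big1_fset ?addr0// => l.
    by rewrite !inE => /andP[/negPf lk _] _; rewrite eq_sym lk mulr0.
  rewrite big1_fset// => l lA _.
  by case: eqP kA => [->|]; rewrite ?lA ?mulr0.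
have mk : cmeas (fun x => ((fejer_kernel p N x)%:C)%C).
  by apply: cmeas_real; exact: rmeas_kernel.
have mfA : cmeas fA.
  apply: cmeas_sum => l; apply: cmeasM; first exact: cmeas_cst.
  by apply: cmeas_real; exact: measurable_nearestv.
have [ci2 i2] : cintegrable (fun x => ((fejer_kernel p N x)%:C)%C * fA x) /\
    integralC (fun x => ((fejer_kernel p N x)%:C)%C * fA x) =
    ((p ^+ n)%:C)%C * \sum_(l <- A) f (lat p l).
  have -> : (fun x => ((fejer_kernel p N x)%:C)%C * fA x) = fun x =>
      \sum_(l <- A) f (lat p l) * ((fejer_kernel p N x * (nearestv p x == l)%:R)%:C)%C.
    apply/funext => x; rewrite /fA mulr_sumr; apply: eq_bigr => l _.
    by rewrite realcM mulrCA.
  have ci l := cintegrableZ (f (lat p l)) (integralC_kernel_cell N l p0).1.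
  have [c1 ->] := cintegrable_sum A (fun l => (ci l).1).
  split => //; rewrite mulr_sumr; apply: eq_bigr => l _.
  by rewrite (ci l).2 (integralC_kernel_cell N l p0).2 mulrC.
(* the distance in the j-th coordinate is paid for by the j-th factor of the
   kernel, which leaves the constant density 1 in that coordinate *)
pose kj (j i : 'I_n) : R -> R := if i == j then (fun=> 1) else fejer p N.
have kjk j i : cell_kernel p (kj j i).
  by rewrite /kj; case: ifP => _; [exact: one_cell_kernel|exact: fejer_cell_kernel].
pose h x := \sum_(j < n) (fejer_kernel p N x * (L * d * weight (lat p (nearestv p x)))
     + \prod_i kj j i (x 0 i) * (L * d * weight (lat p (nearestv p x))))
   + fejer_kernel p N x * (C * weight (lat p (nearestv p x)) * (nearestv p x \notin A)%:R).
have Ld0 : 0 <= L * d by rewrite mulr_ge0// ltW.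
have hI : integral_bound h (\sum_(j < n) (p ^+ n * (L * d * S) + p ^+ n * (L * d * S))
    + p ^+ n * (C * d)).
  apply: integral_boundD; first (apply: integral_bound_sum => j; apply: integral_boundD).
  - apply: (@integral_bound_step p (fun=> fejer p N) (fun l => L * d * weight (lat p l))) => //.
    + by move=> _; exact: fejer_cell_kernel.
    + by move=> l; rewrite mulr_ge0// weight_ge0.
    + by move=> B; rewrite -mulr_sumr ler_wpM2l.
  - apply: (@integral_bound_step p (kj j) (fun l => L * d * weight (lat p l))) => //.
    + by move=> l; rewrite mulr_ge0// weight_ge0.
    + by move=> B; rewrite -mulr_sumr ler_wpM2l.
  - apply: (@integral_bound_step p (fun=> fejer p N)
      (fun l => C * weight (lat p l) * (l \notin A)%:R)) => //.
    + by move=> _; exact: fejer_cell_kernel.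
    + by move=> l; rewrite !mulr_ge0// weight_ge0.
    + move=> B; under eq_bigr do rewrite -mulrA.
      rewrite -mulr_sumr ler_wpM2l//.
      apply: (@le_trans _ _ (\sum_(l <- (A `|` B)%fset) weight (lat p l) -
        \sum_(l <- A2) weight (lat p l))); last first.
        by apply: hA2; rewrite -fsetUA fsubsetU// fsubsetUl orbT.
      have : \sum_(l <- B) weight (lat p l) * (l \notin A)%:R +
          \sum_(l <- A) weight (lat p l) <= \sum_(l <- (A `|` B)%fset) weight (lat p l).
        have -> : \sum_(l <- A) weight (lat p l) =
            \sum_(l <- (A `|` B)%fset) weight (lat p l) * (l \in A)%:R.
          rewrite -(big_fset_incl _ (fsubsetUl A B)).
            by apply: eq_fbigr => l lA _; rewrite lA mulr1.
          by move=> l _ /negPf ->; rewrite mulr0.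
        have Wb l : 0 <= weight (lat p l) * (l \notin A)%:R by rewrite mulr_ge0// weight_ge0.
        have := sum_fset_le Wb (fsubsetUr A B).
        rewrite -(lerD2r (\sum_(l <- (A `|` B)%fset) weight (lat p l) * (l \in A)%:R)).
        move=> /le_trans; apply; rewrite -big_split /= ler_sum// => l _.
        by case: (l \in A); rewrite ?mulr0 ?mulr1 ?add0r ?addr0.
      have := sum_fset_le (fun l => weight_ge0 (lat p l)) (fsubsetUr A1 A2).
      rewrite -/A; lra.
have [mh _ hle] := hI.
have m1 : cmeas (fun x => ((fejer_kernel p N x)%:C)%C * (f x - fA x)).
  by apply: cmeasM => //; exact: cmeasB.
have fh x : nm (((fejer_kernel p N x)%:C)%C * (f x - fA x)) <= h x.
  rewrite normc_mul normc_real (ger0_norm (kernel_ge0 _ _ _)).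
  have k0 := kernel_ge0 p N x.
  have W0 : 0 <= weight (lat p (nearestv p x)) by exact: weight_ge0.
  have b1 : nm (f x - f (lat p (nearestv p x))) <=
      L * (\sum_j `|x 0 j - p * (nearestv p x 0 j)%:~R|) * weight (lat p (nearestv p x)).
    have -> : \sum_j `|x 0 j - p * (nearestv p x 0 j)%:~R| =
        \sum_j `|x 0 j - lat p (nearestv p x) 0 j|.
      by apply: eq_bigr => j _; rewrite !mxE.
    by apply: hL => j; rewrite !mxE; exact: nearest_dist.
  have b2 : nm (f (lat p (nearestv p x)) - fA x) <=
      C * weight (lat p (nearestv p x)) * (nearestv p x \notin A)%:R.
    rewrite fAE; case: (_ \in A) => /=.
      by rewrite subrr ComplexField.Normc.normc0 mulr0.
    by rewrite subr0 mulr1; exact: fC.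
  apply: (@le_trans _ _ (fejer_kernel p N x *
      (L * (\sum_j `|x 0 j - p * (nearestv p x 0 j)%:~R|) *
      weight (lat p (nearestv p x)) +
      C * weight (lat p (nearestv p x)) * (nearestv p x \notin A)%:R))).
    rewrite ler_wpM2l// -(subrK (f (lat p (nearestv p x))) (f x)) -addrA.
    by apply: le_trans (normcD _ _) _; rewrite lerD.
  rewrite /h mulrDr lerD2r.
  rewrite mulr_sumr mulr_suml mulr_sumr ler_sum// => j _.
  have := hN0 N x j NN.
  rewrite [X in _ -> _ <= _ + X * _](_ : _ =
    \prod_i (if i == j then 1 else fejer p N (x 0 i))); last first.
    by apply: eq_bigr => i _; rewrite /kj; case: ifP.
  set P := \prod_i _; set k := fejer_kernel p N x; set w := weight _; set a := `|_| => hh.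
  have LW : 0 <= L * w by rewrite mulr_ge0.
  have := ler_wpM2r LW hh; rewrite /k; lra.
have [ci1 i1] := integralC_le m1 mh fh hle.
have -> : (fun x => ((fejer_kernel p N x)%:C)%C * f x) = fun x =>
    ((fejer_kernel p N x)%:C)%C * (f x - fA x) + ((fejer_kernel p N x)%:C)%C * fA x.
  by apply/funext => x; rewrite -mulrDr subrK.
rewrite integralCD// i2 -addrA -mulrBr; apply: (le_trans (normcD _ _)).
have A1A : (A1 `<=` A)%fset by exact: fsubsetUl.
have := hA1 A A1A; rewrite normc_mul normc_real (ger0_norm pn0) => h2.
apply: (le_trans (lerD i1 (ler_wpM2l pn0 h2))).
have -> : 2 * (\sum_(j < n) (p ^+ n * (L * d * S) + p ^+ n * (L * d * S)) + p ^+ n * (C * d))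
   + p ^+ n * d = T * d.
  by rewrite sumr_const card_ord -mulr_natl /T; ring.
rewrite /d mulrCA; apply: ler_piMr; first exact: ltW.
by rewrite ler_pdivrMr ?ltr_wpDl// mul1r lerDl.
Qed.

End sampling.

(** * Differences and partial derivatives *)

Section differences.
Context {R : realType} {n : nat}.
Local Notation e_ j := (delta_mx 0 j : 'rV[R]_n).
Implicit Types (g u : 'rV[R]_n -> R) (phi : 'rV[R]_n -> R[i]).

Lemma derive_shift g (x v w : 'rV[R]_n) : derivable g (x + w) v ->
  derivable (fun y => g (y + w)) x v /\ 'D_v (fun y => g (y + w)) x = 'D_v g (x + w).
Proof.
have E : (fun h : R => h^-1 *: (((fun y => g (y + w)) \o shift x) (h *: v) - g (x + w))) =
         (fun h : R => h^-1 *: ((g \o shift (x + w)) (h *: v) - g (x + w))).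
  by apply/funext => h /=; rewrite addrA.
by rewrite /derivable /derive E.
Qed.

Lemma derivable_line g (x v : 'rV[R]_n) (s : R) : derivable g (x + s *: v) v ->
  is_derive s 1 (fun s : R => g (x + s *: v)) ('D_v g (x + s *: v)).
Proof.
move=> dg.
have E : (fun h : R => h^-1 *:
      (((fun s : R => g (x + s *: v)) \o shift s) (h *: (1 : R)) - g (x + s *: v))) =
         (fun h : R => h^-1 *: ((g \o shift (x + s *: v)) (h *: v) - g (x + s *: v))).
  apply/funext => h; have -> : h *: (1 : R) = h by exact: mulr1.
  by rewrite /= scalerDl addrCA.
apply: DeriveDef; first by rewrite /derivable E.
by rewrite /derive E.
Qed.

Lemma mvt_line g (v : 'rV[R]_n) : (forall x, derivable g x v) ->
  forall x (t : R), exists2 s : R, `|s| <= `|t| &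
    g (x + t *: v) - g x = t * 'D_v g (x + s *: v).
Proof.
move=> dg x t; pose f (s : R) := g (x + s *: v).
have df (s : R) : is_derive s 1 f ('D_v g (x + s *: v)) by exact: derivable_line.
have cf (A : set R) : {within A, continuous f}.
  apply: continuous_subspaceT => s; apply: differentiable_continuous.
  by apply/derivable1_diffP; have [] := df s.
have f0 : g x = f 0 by rewrite /f scale0r addr0.
rewrite f0 -/(f t); case: (ltgtP t 0) => [t0|t0|->].
- have [s] := MVT t0 (fun s _ => df s) (cf _).
  rewrite in_itv /= => /andP[s1 s2]; rewrite sub0r mulrN => E.
  exists s; first by rewrite !ltr0_norm// lerN2 ltW.
  by rewrite -opprB E opprK mulrC.
- have [s] := MVT t0 (fun s _ => df s) (cf _).
  rewrite in_itv /= => /andP[s1 s2]; rewrite subr0 => E.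
  exists s; first by rewrite !gtr0_norm// ltW.
  by rewrite E mulrC.
- by exists 0; rewrite ?subrr ?mul0r.
Qed.

Definition dif (v : 'rV[R]_n) g := fun x => g x - g (x + v).

Lemma partial_dif (s : seq 'I_n) v g : smooth g ->
  partial s (dif v g) = dif v (partial s g).
Proof.
move=> sg; elim: s => [//|j s /= ->]; apply/funext => x.
have [_ ds] := sg s; have [d1 e1] := derive_shift (ds j (x + v)).
by rewrite deriveB ?e1.
Qed.

Lemma smooth_dif v g : smooth g -> smooth (dif v g).
Proof.
move=> sg s; rewrite partial_dif//; have [cs ds] := sg s; split.
  move=> x; have h1 := cs (x + v).
  have h0 : (fun y : 'rV[R]_n => y + v) @ nbhs x --> x + v.
    exact: (cvgD cvg_id (cvg_cst v)).
  exact: (cvgB (cs x) (cvg_comp _ _ h0 h1)).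
move=> j x; apply: derivableB => //.
exact: (derive_shift (ds j (x + v))).1.
Qed.

Definition difs (t : 'I_n -> R) (s : seq 'I_n) g :=
  foldl (fun g j => dif (t j *: e_ j) g) g s.

Local Notation c := (4 ^+ n : R).

Lemma weight_line (x : 'rV[R]_n) (j : 'I_n) (s : R) : `|s| <= 1 ->
  weight (x + s *: e_ j) <= c * weight x.
Proof.
move=> s1; have -> : c = (2 + 2 * 1 ^+ 2) ^+ n by congr (_ ^+ _); ring.
apply: weight_near => // i; rewrite !mxE eqxx /=.
have -> : x 0 i + s * (i == j)%:R - x 0 i = s * (i == j)%:R by ring.
by case: eqP => _; rewrite ?mulr1 ?mulr0 ?normr0.
Qed.

(** The mean value theorem in one coordinate at a time bounds an iterated difference
    by the corresponding iterated partial derivative; differences commute with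
    partial derivatives because the latter commute with translations. *)
Lemma difs_le (t : 'I_n -> R) (s : seq 'I_n) g (C : R) : smooth g -> 0 <= C ->
  (forall j, j \in s -> `|t j| <= 1) ->
  (forall y, `|partial s g y| <= C * weight y) ->
  forall x, `|difs t s g x| <= C * \prod_(j <- s) (c * `|t j|) * weight x.
Proof.
elim: s g C => [|j s IH] g C sg C0 t1 gC x.
  by rewrite big_nil mulr1; exact: gC.
have c0 : 0 <= c by rewrite exprn_ge0.
have tj : `|t j| <= 1 by apply: t1; rewrite mem_head.
rewrite big_cons mulrA; apply: IH.
- exact: smooth_dif.
- by rewrite !mulr_ge0.
- by move=> i si; apply: t1; rewrite inE si orbT.
move=> y; rewrite partial_dif// /dif.
have [_ ds] := sg s.
have [r rt E] := mvt_line (ds j) y (t j).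
rewrite distrC E normrM.
apply: (@le_trans _ _ (`|t j| * (C * (c * weight y)))); last first.
  by rewrite le_eqVlt; apply/orP; left; apply/eqP; ring.
rewrite ler_wpM2l//; apply: (le_trans (gC _)); rewrite ler_wpM2l//.
by apply: weight_line; exact: le_trans rt tj.
Qed.

(** One coordinate is changed at a time, each change being controlled by a partial
    derivative. *)
Lemma smooth_weighted_lip u (C : R) : smooth u -> 0 <= C ->
  (forall j y, `|partial [:: j] u y| <= C * weight y) ->
  forall (r : R) (x y : 'rV[R]_n), 0 <= r -> (forall j, `|x 0 j - y 0 j| <= r) ->
   `|u x - u y| <= C * (2 + 2 * r ^+ 2) ^+ n * (\sum_j `|x 0 j - y 0 j|) * weight y.
Proof.
move=> su C0 uC r x y r0 xy.
(* the points z i lead from y to x, changing one coordinate at a time *)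
pose z (i : nat) : 'rV[R]_n := \row_j (if (j < i)%N then x 0 j else y 0 j).
have -> : x = z n by apply/rowP => j; rewrite mxE ltn_ord.
have -> : y = z 0%N by apply/rowP => j; rewrite mxE.
rewrite -(telescope_sumr (fun i => u (z i)))// big_mkord.
apply: (le_trans (ler_norm_sum _ _ _)).
have z0 : z 0%N = y by apply/rowP => j; rewrite mxE.
have zn : z n = x by apply/rowP => j; rewrite mxE ltn_ord.
rewrite z0 zn mulr_sumr mulr_suml ler_sum// => i _.
have zE : z i.+1 = z i + (x 0 i - y 0 i) *: e_ i.
  apply/rowP => j; rewrite !mxE eqxx /= ltnS.
  case: (ltngtP j i) => [ji|ij|/val_inj ->].
  - rewrite (_ : (j == i) = false) ?mulr0 ?addr0//.
    by apply/negP => /eqP ji'; rewrite ji' ltnn in ji.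
  - rewrite (_ : (j == i) = false) ?mulr0 ?addr0//.
    by apply/negP => /eqP ji'; rewrite ji' ltnn in ij.
  - by rewrite eqxx mulr1 addrC subrK.
have [_ ds] := su [::].
have [s st E] := mvt_line (ds i) (z i) (x 0 i - y 0 i).
rewrite zE E normrM.
have := uC i (z i + s *: e_ i); rewrite /= => h.
apply: (@le_trans _ _ (`|x 0 i - y 0 i| * (C * ((2 + 2 * r ^+ 2) ^+ n * weight y)))); last first.
  by rewrite le_eqVlt; apply/orP; left; apply/eqP; ring.
rewrite ler_wpM2l//; apply: (le_trans h); rewrite ler_wpM2l//.
apply: weight_near => // j; rewrite !mxE eqxx /=.
case: (ltngtP j i) => [ji|ij|/val_inj ->].
- rewrite (_ : (j == i) = false) ?mulr0 ?addr0//.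
  by apply/negP => /eqP ji'; rewrite ji' ltnn in ji.
- rewrite (_ : (j == i) = false) ?mulr0 ?addr0 ?subrr ?normr0//.
  by apply/negP => /eqP ji'; rewrite ji' ltnn in ij.
- rewrite eqxx mulr1 (_ : y 0 i + s - y 0 i = s); last by ring.
  exact: le_trans st (xy i).
Qed.

End differences.

(** * Decay of Schwartz functions *)

Section schwartz_facts.
Context {R : realType} {n : nat}.
Local Notation nm := (@ComplexField.Normc.normc R).
Implicit Types (phi psi : 'rV[R]_n -> R[i]).

Lemma enorm_ge0 (x : 'rV[R]_n) : 0 <= enorm x.
Proof. exact: sqrtr_ge0. Qed.

Lemma enorm_sqr (x : 'rV[R]_n) : enorm x ^+ 2 = \sum_j x 0 j ^+ 2.
Proof.
rewrite /enorm sqr_sqrtr; last by apply: sumr_ge0 => j _; rewrite -expr2 sqr_ge0.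
by apply: eq_bigr => j _; rewrite expr2.
Qed.

Lemma coord_le_enorm (x : 'rV[R]_n) j : `|x 0 j| <= enorm x.
Proof.
rewrite -ler_sqr ?nnegrE ?enorm_ge0// enorm_sqr real_normK ?num_real//.
by rewrite (bigD1 j)//= lerDl; apply: sumr_ge0 => i _; exact: sqr_ge0.
Qed.

Lemma weight_enorm (x : 'rV[R]_n) : 1 <= (1 + enorm x) ^+ (2 * n) * weight x.
Proof.
have aE (a : R) : a ^+ n = \prod_(j < n) a by rewrite prodr_const card_ord.
rewrite exprM aE /weight -big_split /= -[leLHS](expr1n R n) aE.
apply: ler_prod => j _; rewrite ler01 /= ler_pdivlMr ?ltr_pwDl ?sqr_ge0// mul1r.
have := coord_le_enorm x j; have := enorm_ge0 x.
rewrite -[x 0 j ^+ 2]real_normK ?num_real//.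
by have := normr_ge0 (x 0 j); nra.
Qed.

Lemma schwartz_seminorm phi : schwartz phi -> forall k s, exists2 M : R, 0 <= M &
  forall x, (1 + enorm x) ^+ k * nm (partialC s phi x) <= M.
Proof.
move=> [_ _ h] k s; have := h k s; rewrite /seminorm.
set S := ereal_sup _ => Soo.
have ub x : (((1 + enorm x) ^+ k * nm (partialC s phi x))%:E <= S)%E.
  by apply: ereal_sup_ubound; exists x.
have S0 : (0 <= S)%E.
  apply: le_trans (ub 0); rewrite lee_fin mulr_ge0 ?normc_ge0//.
  by rewrite exprn_ge0// addr_ge0// enorm_ge0.
have Sf : S \is a fin_num by rewrite ge0_fin_numE.
exists (fine S); first exact: fine_ge0.
by move=> x; rewrite -lee_fin fineK.
Qed.

Lemma schwartz_decay phi : schwartz phi -> forall s, exists2 C : R, 0 <= C &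
  forall x, nm (partialC s phi x) <= C * weight x.
Proof.
move=> sp s; have [M M0 hM] := schwartz_seminorm sp (2 * n) s.
exists M => // x; have := weight_enorm x; have := hM x.
set a := _ ^+ _; set b := nm _ => h1 h2.
apply: (@le_trans _ _ (a * weight x * b)); first by rewrite ler_peMl// normc_ge0.
by rewrite mulrAC ler_wpM2r// weight_ge0.
Qed.

(** The additional factor pays for one power of x, that is, for a Lipschitz bound of
    the Fourier transform. *)
Lemma schwartz_decay1 phi : schwartz phi -> exists2 C : R, 0 <= C &
  forall x, (1 + enorm x) * nm (phi x) <= C * weight x.
Proof.
move=> sp; have [M M0 hM] := schwartz_seminorm sp (2 * n).+1 [::].
exists M => // x; have := weight_enorm x; have := hM x.
rewrite (_ : partialC [::] phi x = phi x); last by rewrite /partialC /=; case: (phi x).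
rewrite exprS; set a := _ ^+ _; set b := nm _; set d := 1 + enorm x => h1 h2.
have d0 : 0 <= d by rewrite addr_ge0// enorm_ge0.
apply: (@le_trans _ _ (a * weight x * (d * b))).
  by rewrite ler_peMl// mulr_ge0// normc_ge0.
rewrite mulrAC ler_wpM2r// ?weight_ge0// mulrA (mulrC a)//.
Qed.

Lemma schwartz_decay0 phi : schwartz phi -> exists2 C : R, 0 <= C & decay C phi.
Proof.
move=> sp; have [C C0 h] := schwartz_decay sp [::].
exists C => // x; have := h x.
by rewrite (_ : partialC [::] phi x = phi x)// /partialC /=; case: (phi x).
Qed.

Lemma schwartz_cmeas phi : schwartz phi -> cmeas phi.
Proof.
move=> [sr si _]; apply: cmeas_continuous.
  exact: (sr [::]).1.
exact: (si [::]).1.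
Qed.

Lemma schwartz_weighted_lip phi : schwartz phi -> weighted_lip phi.
Proof.
move=> sp; have [sr si _] := sp.
have [|Cj hCj] := @choice 'I_n R (fun j C =>
    0 <= C /\ forall y, nm (partialC [:: j] phi y) <= C * weight y).
  by move=> j; have [C C0 hC] := schwartz_decay sp [:: j]; exists C.
pose C := \sum_j Cj j.
have C0 : 0 <= C by apply: sumr_ge0 => j _; have [] := hCj j.
have hC j y : nm (partialC [:: j] phi y) <= C * weight y.
  have [_ h] := hCj j; apply: (le_trans (h y)); rewrite ler_wpM2r ?weight_ge0//.
  rewrite /C (bigD1 j)//= lerDl sumr_ge0// => i _; by have [] := hCj i.
move=> r r0; exists (2 * (C * (2 + 2 * r ^+ 2) ^+ n)); split.
  by rewrite !mulr_ge0// exprn_ge0// addr_ge0// mulr_ge0// sqr_ge0.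
move=> x y xy; apply: (le_trans (normc_le_ReIm _)).
have h1 j z : `|partial [:: j] (fun y => complex.Re (phi y)) z| <= C * weight z.
  by apply: le_trans (hC j z); exact: (Re_le_normc (partialC [:: j] phi z)).
have h2 j z : `|partial [:: j] (fun y => complex.Im (phi y)) z| <= C * weight z.
  by apply: le_trans (hC j z); exact: (Im_le_normc (partialC [:: j] phi z)).
have b1 := smooth_weighted_lip sr C0 h1 r0 xy; have b2 := smooth_weighted_lip si C0 h2 r0 xy.
rewrite ReD ImD ReN ImN; apply: (le_trans (lerD b1 b2)).
by rewrite le_eqVlt; apply/orP; left; apply/eqP; ring.
Qed.

End schwartz_facts.

(** * Fourier coefficients and the inverse Fourier transform *)

Section fourier_bounds.
Context {R : realType} {n : nat}.
Local Notation nm := (@ComplexField.Normc.normc R).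
Local Notation K := 'rV[int]_n.
Local Notation e_ j := (delta_mx 0 j : 'rV[R]_n).
Implicit Types (f phi psi : 'rV[R]_n -> R[i]) (a v : 'rV[R]_n).

Lemma integral_boundZ (C S : R) (h : 'rV[R]_n -> R) : 0 <= C -> integral_bound h S ->
  integral_bound (fun x => C * h x) (C * S).
Proof.
move=> C0 [mh h0 hS]; split.
- by apply: measurable_funM => //; exact: measurable_cst.
- by move=> x; rewrite mulr_ge0.
- under eq_integral => t _ do rewrite EFinM.
  rewrite ge0_integralZl//.
  + by rewrite EFinM lee_wpmul2l// lee_fin.
  + exact/measurable_EFinP.
  + by move=> t _; rewrite lee_fin.
Qed.

Lemma integralC_decay f (C IW : R) : integral_bound (@weight R n) IW -> 0 <= C ->
  cmeas f -> decay C f -> cintegrable f /\ nm (integralC f) <= 2 * (C * IW).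
Proof.
move=> hW C0 mf fC; have [mh _ hS] := integral_boundZ C0 hW.
exact: integralC_le mf mh fC hS.
Qed.

Lemma dotpDr a x v : dotp a (x + v) = dotp a x + dotp a v.
Proof. by rewrite /dotp -big_split; apply: eq_bigr => j _; rewrite mxE mulrDr. Qed.

Lemma dotpC x v : dotp x v = dotp v x :> R.
Proof. by apply: eq_bigr => j _; rewrite mulrC. Qed.

Lemma dotp_delta a (s : R) j : dotp a (s *: e_ j) = a 0 j * s.
Proof.
rewrite /dotp (bigD1 j)//= !mxE !eqxx mulr1 big1 ?addr0// => i ij.
by rewrite !mxE (negPf ij) andbF !mulr0.
Qed.

Lemma cmeas_char a : cmeas (fun x => expi (dotp a x)).
Proof. by apply: cmeas_expi; exact: rmeas_dotp. Qed.

Lemma decay_char a f C : decay C f -> decay C (fun x => expi (dotp a x) * f x).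
Proof. by move=> fC x; rewrite normc_mul normc_expi mul1r. Qed.

Lemma exp_dist_le a f (C IW : R) : integral_bound (@weight R n) IW -> 0 <= C ->
  cmeas f -> decay C f ->
  cintegrable (fun x => expi (dotp a x) * f x) /\ nm (exp_dist a f) <= 2 * (C * IW).
Proof.
move=> hW C0 mf fC; apply: integralC_decay => //; last exact: decay_char.
by apply: cmeasM => //; exact: cmeas_char.
Qed.

Definition cdif v f := fun x => f x - f (x + v).

Lemma decay_cdif v f (C : R) : 0 <= C -> decay C f ->
  exists2 C', 0 <= C' & decay C' (cdif v f).
Proof.
move=> C0 fC; pose r := \sum_j `|v 0 j|.
have r0 : 0 <= r by apply: sumr_ge0.
have d0 : 0 <= (2 + 2 * r ^+ 2) ^+ n.
  by rewrite exprn_ge0// addr_ge0// mulr_ge0// sqr_ge0.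
exists (C + C * (2 + 2 * r ^+ 2) ^+ n); first by rewrite addr_ge0// mulr_ge0.
move=> x; apply: (le_trans (normcB _ _)); rewrite mulrDl lerD//.
apply: (le_trans (fC _)); rewrite -mulrA ler_wpM2l//; apply: weight_near => // j.
rewrite mxE [x 0 j + _]addrC addrK /r (bigD1 j)//= lerDl.
by apply: sumr_ge0.
Qed.

(** Translating by half a period of the character changes the sign of the integral. *)
Lemma exp_dist_cdif a v f (C : R) : 0 <= C -> cmeas f -> decay C f ->
  dotp a v = pi -> exp_dist a (cdif v f) = ((2 : R)%:C)%C * exp_dist a f.
Proof.
move=> C0 mf fC av; have [IW hW] := @weight_integral_bound R n.
have [C' C'0 fC'] := decay_cdif v C0 fC.
have m1 : cmeas (fun x => expi (dotp a x) * f x).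
  by apply: cmeasM => //; exact: cmeas_char.
have [i1 _] := exp_dist_le a hW C0 mf fC.
have mv : cmeas (cdif v f) by apply: cmeasB => //; exact: cmeas_shift.
have [i2 _] := exp_dist_le a hW C'0 mv fC'.
have E x : expi (dotp a x) * f x = expi (dotp a x) * cdif v f x -
    expi (dotp a (x + v)) * f (x + v).
  rewrite dotpDr expiD av; have -> : expi pi = -1 :> R[i].
    by apply: complex_eq; rewrite /expi /= ?cospi ?sinpi ?oppr0.
  by rewrite mulrN1 mulNr opprK -mulrDr subrK.
have i3 : cintegrable (fun x => expi (dotp a (x + v)) * f (x + v)).
  have -> : (fun x => expi (dotp a (x + v)) * f (x + v)) =
    fun x => expi (dotp a x) * cdif v f x - expi (dotp a x) * f x.
    by apply/funext => x; rewrite [X in _ - X]E opprB addrCA subrr addr0.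
  exact: (cintegrableB i2 i1).1.
have E2 : exp_dist a f = exp_dist a (cdif v f) - exp_dist a f.
  rewrite {1}/exp_dist /regular (_ : (fun x => _) = fun x => expi (dotp a x) * cdif v f x -
    expi (dotp a (x + v)) * f (x + v)); last by apply/funext => x; exact: E.
  rewrite (cintegrableB i2 i3).2; congr (_ - _).
  exact: (@integralC_shift _ _ v (fun x => expi (dotp a x) * f x)).
have -> : ((2 : R)%:C)%C = 1 + 1 by rewrite -(rmorph1 (real_complex R)) -rmorphD.
by rewrite mulrDl mul1r {1}E2 subrK.
Qed.

Definition cdifs (t : 'I_n -> R) (s : seq 'I_n) f :=
  foldl (fun f j => cdif (t j *: e_ j) f) f s.

Lemma Re_cdifs t s f x :
  complex.Re (cdifs t s f x) = difs t s (fun x => complex.Re (f x)) x.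
Proof.
elim: s f => [//|j s IH] f; rewrite /= IH; congr (difs _ _ _ x).
by apply/funext => y; rewrite /cdif ReD ReN.
Qed.

Lemma Im_cdifs t s f x :
  complex.Im (cdifs t s f x) = difs t s (fun x => complex.Im (f x)) x.
Proof.
elim: s f => [//|j s IH] f; rewrite /= IH; congr (difs _ _ _ x).
by apply/funext => y; rewrite /cdif ImD ImN.
Qed.

Lemma exp_dist_cdifs a t s f (C : R) : 0 <= C -> cmeas f -> decay C f ->
  (forall j, j \in s -> a 0 j * t j = pi) ->
  cmeas (cdifs t s f) /\
  exp_dist a (cdifs t s f) = ((\prod_(j <- s) (2 : R))%:C)%C * exp_dist a f.
Proof.
elim: s f C => [|j s IH] f C C0 mf fC at_pi.
  by rewrite big_nil mul1r.
have [C' C'0 fC'] := decay_cdif (t j *: e_ j) C0 fC.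
have mv : cmeas (cdif (t j *: e_ j) f) by apply: cmeasB => //; exact: cmeas_shift.
have [|m ->] := IH _ _ C'0 mv fC'.
  by move=> i si; apply: at_pi; rewrite inE si orbT.
split=> //; rewrite (exp_dist_cdif C0 mf fC).
  by rewrite big_cons mulrA -realcM (mulrC 2).
by rewrite dotp_delta at_pi// mem_head.
Qed.

(** Each coordinate of A occurs twice, as second differences are needed to gain the
    summable factor 1 / k_j^2. *)
Definition twice (A : {set 'I_n}) := enum A ++ enum A.

Lemma big_twice (A : {set 'I_n}) (F : 'I_n -> R) :
  \prod_(j <- twice A) F j = \prod_(j in A) F j ^+ 2.
Proof.
by rewrite /twice big_cat big_enum /= -big_split.
Qed.

Lemma mem_twice (A : {set 'I_n}) j : j \in twice A -> j \in A.
Proof.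
by rewrite /twice mem_cat orbb mem_enum.
Qed.

(** Second differences by half a period 1 / (2 k_j), in each coordinate with k_j <> 0,
    multiply the integral by 4 each; being bounded by second derivatives times the
    squares of the steps, they gain the factor 1 / k_j^2. *)
Theorem fourier_coef_decay phi : schwartz phi -> exists2 C : R, 0 <= C &
  forall k : K, nm (exp_dist (lat (2 * pi) k) phi) <= C * weight (lat 1 k).
Proof.
move=> sp; have [IW hW] := @weight_integral_bound R n.
have IW0 : 0 <= IW.
  have [_ W0 hle] := hW; rewrite -lee_fin; apply: le_trans hle.
  by apply: integral_ge0 => t _; rewrite lee_fin.
have [C0 C00 hC0] := schwartz_decay0 sp.
have mp := schwartz_cmeas sp; have [sr si _] := sp.
have [|CA hCA] := @choice {set 'I_n} R (fun A C =>
    0 <= C /\ forall y, nm (partialC (twice A) phi y) <= C * weight y).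
  by move=> A; have [C ? hC] := schwartz_decay sp (twice A); exists C.
(* one constant for all possible sets of nonzero coordinates of k *)
pose C := \sum_(A : {set 'I_n}) CA A.
have CC0 : 0 <= C by apply: sumr_ge0 => A _; have [] := hCA A.
have hC A y : nm (partialC (twice A) phi y) <= C * weight y.
  have [_ h] := hCA A; apply: (le_trans (h y)); rewrite ler_wpM2r ?weight_ge0//.
  rewrite /C (bigD1 A)//= lerDl sumr_ge0// => i _; by have [] := hCA i.
pose c : R := 4 ^+ n.
have c0 : 0 <= c by rewrite exprn_ge0.
exists (4 * C * IW * (1 + c ^+ 2) ^+ n).
  by rewrite !mulr_ge0// exprn_ge0// addr_ge0// sqr_ge0.
move=> k; pose A : {set 'I_n} := finset (fun j => k 0 j != 0).
have AE j : (j \in A) = (k 0 j != 0) by rewrite finset.in_set.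
pose t j : R := (2 * (k 0 j)%:~R)^-1.
have k1 j : j \in A -> 1 <= `|(k 0 j)%:~R : R|.
  rewrite AE -intr_norm -[1]/(1%:~R) ler_int; move: (k 0 j : int) => z; lia.
have kn0 j : j \in A -> (k 0 j)%:~R != 0 :> R by rewrite AE intr_eq0.
have t1 j : j \in twice A -> `|t j| <= 1.
  move=> /mem_twice jA; rewrite /t normfV invf_le1 ?normr_gt0; last first.
    by rewrite mulf_neq0// kn0.
  by rewrite normrM ger0_norm//; have := k1 j jA; lra.
have at_pi j : j \in twice A -> lat (2 * pi) k 0 j * t j = pi.
  by move=> /mem_twice jA; rewrite /lat !mxE /t; field; rewrite kn0.
have [mc E] := exp_dist_cdifs C00 mp hC0 at_pi.
pose P1 := \prod_(j <- twice A) (c * `|t j|).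
have P10 : 0 <= P1 by apply: prodr_ge0 => j _; rewrite mulr_ge0.
have dC : decay (2 * (C * P1)) (cdifs t (twice A) phi).
  move=> x; apply: (le_trans (normc_le_ReIm _)).
  rewrite -mulrA mulrDl mul1r; apply: lerD.
    rewrite Re_cdifs; apply: difs_le => // y.
    by apply: le_trans (hC A y); exact: (Re_le_normc (partialC (twice A) phi y)).
  rewrite Im_cdifs; apply: difs_le => // y.
  by apply: le_trans (hC A y); exact: (Im_le_normc (partialC (twice A) phi y)).
have D0 : 0 <= 2 * (C * P1) by rewrite !mulr_ge0.
have [_] := exp_dist_le (lat (2 * pi) k) hW D0 mc dC.
pose P2 : R := \prod_(j <- twice A) 2.
have P20 : 0 < P2 by apply: prodr_gt0.
rewrite E normc_mul normc_real (ger0_norm (ltW P20)) => h.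
have PW : P1 / P2 <= (1 + c ^+ 2) ^+ n * weight (lat 1 k).
  rewrite /P1 /P2 -prodf_div big_twice big_mkcond /=.
  have -> : (1 + c ^+ 2) ^+ n = \prod_(j < n) (1 + c ^+ 2).
    by rewrite prodr_const card_ord.
  rewrite /weight -big_split /=; apply: ler_prod => j _.
  have q0 : 0 <= (lat 1 k 0 j : R) ^+ 2 by exact: sqr_ge0.
  have c20 : 0 <= c ^+ 2 by exact: sqr_ge0.
  case: ifPn => [jA|]; last first.
    rewrite AE negbK => /eqP k0; rewrite ler01 /=.
    by rewrite /lat !mxE k0 mulr0 expr0n addr0 invr1 mulr1 lerDl.
  rewrite sqr_ge0 /= ler_pdivlMr ?ltr_pwDl//.
  have -> : lat 1 k 0 j = (k 0 j)%:~R :> R by rewrite /lat !mxE mul1r.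
  rewrite /t normfV normrM (ger0_norm (ler0n _ 2)).
  have := k1 j jA; rewrite -[(k 0 j)%:~R ^+ 2]real_normK ?num_real//.
  set z := `|_| => z1.
  have z0 : 0 < z by lra.
  have -> : (c * (2 * z)^-1 / 2) ^+ 2 = c ^+ 2 / (16 * z ^+ 2) by field; rewrite gt_eqF.
  rewrite mulrAC ler_pdivrMr; last by nra.
  have z2 : 1 <= z ^+ 2 by nra.
  move: (c ^+ 2) c20 (z ^+ 2) z2 => d d0 w w1; nra.
rewrite -(ler_pM2l P20); apply: (le_trans h).
have := PW; rewrite ler_pdivrMr// => PW'.
have CI0 : 0 <= 4 * C * IW by rewrite !mulr_ge0.
have := ler_wpM2l CI0 PW'; lra.
Qed.

Lemma decay_scale f (C p : R) : 0 < p -> 0 <= C -> decay C f ->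
  decay (C * (1 + p ^- 2) ^+ n) (fun x => f (p *: x)).
Proof.
move=> p0 C0 fC x; apply: (le_trans (fC _)); rewrite -mulrA ler_wpM2l//.
exact: weight_scale.
Qed.

Lemma weighted_lip_scale f (p : R) : 0 < p -> weighted_lip f ->
  weighted_lip (fun x => f (p *: x)).
Proof.
move=> p0 fL r r0; have pr : 0 <= p * r by rewrite mulr_ge0// ltW.
have [L [L0 hL]] := fL _ pr.
have d0 : 0 <= (1 + p ^- 2) ^+ n by rewrite exprn_ge0// addr_ge0// invr_ge0 sqr_ge0.
exists (L * p * (1 + p ^- 2) ^+ n); split; first by rewrite !mulr_ge0// ltW.
move=> x y xy.
have E j : `|(p *: x) 0 j - (p *: y) 0 j| = p * `|x 0 j - y 0 j|.
  by rewrite !mxE -mulrBr normrM gtr0_norm.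
have /hL : forall j, `|(p *: x) 0 j - (p *: y) 0 j| <= p * r.
  by move=> j; rewrite E ler_pM2l.
under eq_bigr do rewrite E.
rewrite -mulr_sumr => /le_trans; apply.
have S0 : 0 <= \sum_j `|x 0 j - y 0 j| by apply: sumr_ge0.
have LpS : 0 <= L * p * \sum_j `|x 0 j - y 0 j| by rewrite !mulr_ge0// ltW.
have := ler_wpM2l LpS (weight_scale y p0); lra.
Qed.

Lemma decayB f1 f2 (C1 C2 : R) : decay C1 f1 -> decay C2 f2 ->
  decay (C1 + C2) (fun x => f1 x - f2 x).
Proof.
by move=> h1 h2 x; apply: (le_trans (normcB _ _)); rewrite mulrDl lerD.
Qed.

Lemma weighted_lipB f1 f2 : weighted_lip f1 -> weighted_lip f2 ->
  weighted_lip (fun x => f1 x - f2 x).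
Proof.
move=> h1 h2 r r0; have [L1 [L10 hL1]] := h1 _ r0; have [L2 [L20 hL2]] := h2 _ r0.
exists (L1 + L2); split; first exact: addr_ge0.
move=> x y xy; have -> : f1 x - f2 x - (f1 y - f2 y) = f1 x - f1 y - (f2 x - f2 y) by ring.
by apply: (le_trans (normcB _ _)); rewrite !mulrDl lerD; [|exact: hL1|exact: hL2].
Qed.

Definition bounded_lip (B L : R) f := (forall x, nm (f x) <= B) /\
  forall x y, nm (f x - f y) <= L * \sum_j `|x 0 j - y 0 j|.

Lemma decayM f b (C B L : R) : 0 <= C -> decay C f -> bounded_lip B L b ->
  decay (C * B) (fun x => f x * b x).
Proof.
move=> C0 fC [bB _] x; rewrite normc_mul mulrAC ler_pM// normc_ge0//.
Qed.

Lemma weighted_lipM f b (C B L : R) : 0 <= C -> 0 <= B -> 0 <= L -> decay C f -> weighted_lip f ->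
  bounded_lip B L b -> weighted_lip (fun x => f x * b x).
Proof.
move=> C0 B0 L0 fC fL [bB bL] r r0; have [L1 [L10 hL1]] := fL _ r0.
exists (L1 * B + C * L); split; first by rewrite addr_ge0// mulr_ge0.
move=> x y xy; have -> : f x * b x - f y * b y =
    (f x - f y) * b x + f y * (b x - b y) by ring.
apply: (le_trans (normcD _ _)); rewrite !normc_mul.
have S0 : 0 <= \sum_j `|x 0 j - y 0 j| by apply: sumr_ge0.
have h1 := ler_pM (normc_ge0 _) (normc_ge0 _) (hL1 x y xy) (bB x).
have h2 := ler_pM (normc_ge0 _) (normc_ge0 _) (fC y) (bL x y).
apply: (le_trans (lerD h1 h2)); rewrite le_eqVlt; apply/orP; left; apply/eqP; ring.
Qed.

Lemma near_sum_le (x : 'rV[R]_n) (L e : R) : 0 < e ->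
  \forall y \near nbhs x, L * \sum_j `|x 0 j - (y : 'rV[R]_n) 0 j| <= e.
Proof.
move=> e0; pose d := e / (`|L| * n%:R + 1).
have D0 : 0 < `|L| * n%:R + 1 by rewrite ltr_wpDl// mulr_ge0.
have d0 : 0 < d by rewrite divr_gt0.
have : \forall y \near nbhs x, ball x d y by exact: nbhsx_ballx.
apply: filterS => y [_ xy].
have S : \sum_(j < n) `|x 0 j - y 0 j| <= n%:R * d.
  apply: (@le_trans _ _ (\sum_(j < n) d)); last first.
    by rewrite sumr_const card_ord mulr_natl.
  by apply: ler_sum => j _; apply: ltW; exact: (xy 0 j).
have S0 : 0 <= \sum_(j < n) `|x 0 j - y 0 j| by apply: sumr_ge0.
apply: (@le_trans _ _ (`|L| * (n%:R * d))).
  apply: (@le_trans _ _ (`|L| * \sum_(j < n) `|x 0 j - y 0 j|)).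
    by rewrite ler_wpM2r// ler_norm.
  by rewrite ler_wpM2l.
rewrite mulrA /d mulrCA; apply: ler_piMr; first exact: ltW.
by rewrite ler_pdivrMr// mul1r lerDl.
Qed.

Lemma lip_continuous (g : 'rV[R]_n -> R) (L : R) :
  (forall x y, `|g x - g y| <= L * \sum_j `|x 0 j - y 0 j|) -> continuous g.
Proof.
move=> gL x; suff : g @ nbhs x --> g x by [].
apply/(@cvgrPdist_le _ _ _ (nbhs x) (nbhs_filter x)) => e e0.
by apply: filterS (near_sum_le x L e0) => y; apply: le_trans; exact: gL.
Qed.

Lemma bounded_lip_cmeas (B L : R) f : bounded_lip B L f -> cmeas f.
Proof.
move=> [_ fL]; apply: cmeas_continuous; apply: (@lip_continuous _ L) => x y.
  by rewrite -ReN -ReD (le_trans (Re_le_normc _)).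
by rewrite -ImN -ImD (le_trans (Im_le_normc _)).
Qed.

Lemma lip_derive_le1 (g dg : R -> R) : (forall x : R, is_derive x 1 g (dg x)) ->
  (forall x, `|dg x| <= 1) -> forall x y, `|g x - g y| <= `|x - y|.
Proof.
move=> gd dg1 x y; have cg (A : set R) : {within A, continuous g}.
  apply: continuous_subspaceT => s; apply: differentiable_continuous.
  by apply/derivable1_diffP; have [] := gd s.
wlog xy : x y / x < y.
  move=> h; case: (ltgtP x y) => [|yx|->]; first exact: h.
    by rewrite distrC [leRHS]distrC; exact: h.
  by rewrite !subrr.
have [s _ E] := MVT xy (fun s _ => gd s) (cg _).
by rewrite distrC E normrM distrC ler_piMl.
Qed.

(** The constant 2 comes from estimating cosine and sine separately. *)
Lemma expi_lip (s t : R) : nm (expi s - expi t) <= 2 * `|s - t|.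
Proof.
apply: (le_trans (normc_le_ReIm _)); rewrite ReD ImD ReN ImN /= mulrDl mul1r lerD//.
  apply: (@lip_derive_le1 (@cos R) (fun x => - sin x)) => x.
  by rewrite normrN ler_norml sin_geN1 sin_le1.
apply: (@lip_derive_le1 (@sin R) (@cos R)) => x.
by rewrite ler_norml cos_geN1 cos_le1.
Qed.

(** The increment of the character e^(i x xi) in xi is at most a multiple of |x|, and
    |x| |psi(x)| is integrable. *)
Lemma fourier_inv_lip psi : schwartz psi -> exists B L : R,
  [/\ 0 <= B, 0 <= L & bounded_lip B L (fourier_inv psi)].
Proof.
move=> sp; have [IW hW] := @weight_integral_bound R n.
have IW0 : 0 <= IW.
  have [_ W0 hle] := hW; rewrite -lee_fin; apply: le_trans hle.
  by apply: integral_ge0 => t _; rewrite lee_fin.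
have [C C0 hC] := schwartz_decay0 sp; have [C1 C10 hC1] := schwartz_decay1 sp.
have mp := schwartz_cmeas sp.
pose q := nm (@fourier_cst R n).
have q0 : 0 <= q by exact: normc_ge0.
have int_xi xi : cintegrable (fun x => expi (dotp x xi) * psi x) /\
    nm (integralC (fun x => expi (dotp x xi) * psi x)) <= 2 * (C * IW).
  have -> : (fun x => expi (dotp x xi) * psi x) = fun x => expi (dotp xi x) * psi x.
    by apply/funext => x; rewrite dotpC.
  exact: exp_dist_le.
exists (q * (2 * (C * IW))), (q * (2 * (2 * C1 * IW))); split.
- by rewrite !mulr_ge0.
- by rewrite !mulr_ge0.
split=> [x|x y].
  by rewrite /fourier_inv normc_mul ler_wpM2l// (int_xi x).2.
rewrite /fourier_inv -mulrBr normc_mul -[leRHS]mulrA ler_wpM2l//.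
have [_ <-] := cintegrableB (int_xi x).1 (int_xi y).1.
set S := \sum_j _; have S0 : 0 <= S by apply: sumr_ge0.
have D0 : 0 <= 2 * S * C1 by rewrite !mulr_ge0.
have me z : cmeas (fun x => expi (dotp x z) * psi x).
  apply: cmeasM => //; apply: cmeas_expi.
  rewrite (_ : (fun x => dotp x z) = dotp z); first exact: rmeas_dotp.
  by apply/funext => w; rewrite dotpC.
have [||_ h] := @integralC_decay (fun z => expi (dotp z x) * psi z - expi (dotp z y) * psi z)
    (2 * S * C1) IW hW D0.
- exact: cmeasB.
- move=> z; rewrite -mulrBl normc_mul.
  apply: (@le_trans _ _ (2 * S * ((1 + enorm z) * nm (psi z)))); last first.
    by rewrite -[leRHS]mulrA ler_wpM2l// mulr_ge0.
  rewrite mulrA ler_wpM2r ?normc_ge0//; apply: (le_trans (expi_lip _ _)).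
  rewrite -mulrA ler_wpM2l//.
  rewrite /dotp -sumrB /S mulr_suml; apply: (le_trans (ler_norm_sum _ _ _)).
  apply: ler_sum => j _; rewrite -mulrBr normrM mulrC ler_wpM2l//.
  by apply: (le_trans (coord_le_enorm _ _)); rewrite lerDr.
apply: (le_trans h); rewrite le_eqVlt; apply/orP; left; apply/eqP; ring.
Qed.

End fourier_bounds.

(** * The Dirac comb and Poisson summation *)

Section comb.
Context {R : realType} {n : nat}.
Local Notation nm := (@ComplexField.Normc.normc R).
Local Notation K := 'rV[int]_n.
Implicit Types (f phi psi : 'rV[R]_n -> R[i]) (a v : 'rV[R]_n).

Lemma complex_gt0 (e : R[i]) : 0 < e -> exists2 r : R, 0 < r & e = (r%:C)%C.
Proof.
by case: e => r i; rewrite ltcE /= => /andP[/eqP -> r0]; exists r.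
Qed.

Lemma ball_normc (x y : R[i]^o) (r : R) : nm (x - y) < r -> ball x (r%:C)%C y.
Proof. by move=> h; rewrite /ball /= normc_def ltcR; case: (x - y) h. Qed.

Lemma has_sum_cvg (I : choiceType) (u : I -> R[i]) (s : R[i]) : has_sum u s ->
  partial_sum (u : I -> R[i]^o) @ totally --> (s : R[i]^o).
Proof.
move=> us P /nbhs_ballP[e /= /complex_gt0[r r0 ->]] eP.
have r2 : 0 < r / 2 by lra.
have [A hA] := us _ r2; exists A => // B AB; apply: eP; apply: ball_normc.
have := hA B AB; rewrite normc_distC /partial_sum -(big_seq_fsetE _ B xpredT u); lra.
Qed.

Lemma lipc_continuous f (L : R) :
  (forall x y, nm (f x - f y) <= L * \sum_j `|x 0 j - y 0 j|) ->
  continuous (f : 'rV[R]_n -> R[i]^o).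
Proof.
move=> fL x P /nbhs_ballP[e /= /complex_gt0[r r0 ->]] eP.
have r2 : 0 < r / 2 by lra.
have := near_sum_le x L r2; apply: filterS => y xy; apply: eP; apply: ball_normc.
by have := fL x y; lra.
Qed.

(** The weighted sup norm is dominated by one Schwartz seminorm. The hypotheses range
    over measurable functions with decay, a class that contains
    the differences of Schwartz functions. *)
Lemma tempered_bounded (T : ('rV[R]_n -> R[i]) -> R[i]) (M : R) : 0 <= M ->
  (forall (c : R[i]) f g C D, cmeas f -> cmeas g -> 0 <= C -> 0 <= D ->
     decay C f -> decay D g -> T (fun x => c * f x + g x) = c * T f + T g) ->
  (forall f C, cmeas f -> 0 <= C -> decay C f -> nm (T f) <= M * C) ->
  tempered T.
Proof.
move=> M0 lT bT; split.
  move=> c phi psi sp ss.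
  have [C C0 hC] := schwartz_decay0 sp; have [D D0 hD] := schwartz_decay0 ss.
  exact: lT (schwartz_cmeas sp) (schwartz_cmeas ss) C0 D0 hC hD.
move=> phi sp P /nbhs_ballP[e /= /complex_gt0[r r0 ->]] eP.
pose d := r / (M + 1).
have M1 : 0 < M + 1 by rewrite ltr_wpDl.
have d0 : 0 < d by rewrite divr_gt0.
exists (2 * n, d)%N => //= psi [ss hs]; apply: eP; apply: ball_normc.
have [C C0 hC] := schwartz_decay0 sp; have [D D0 hD] := schwartz_decay0 ss.
have mp := schwartz_cmeas sp; have ms := schwartz_cmeas ss.
have dd : decay d (fun x => psi x - phi x).
  have := hs (2 * n)%N [::] (leqnn _) (leq0n _) => h x.
  have hx : (1 + enorm x) ^+ (2 * n) * nm (psi x - phi x) <= d.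
    rewrite -lee_fin; apply: le_trans (ltW h).
    apply: ereal_sup_ubound; exists x => //=.
    by rewrite /partialC /=; case: (psi x - phi x).
  have := weight_enorm x; set a := _ ^+ _ in hx *; set b := nm _ in hx * => h2.
  apply: (@le_trans _ _ (a * weight x * b)); first by rewrite ler_peMl// normc_ge0.
  by rewrite mulrAC ler_wpM2r// weight_ge0.
have := bT _ _ (cmeasB ms mp) (ltW d0) dd.
have -> : (fun x => psi x - phi x) = fun x => (-1) * phi x + psi x.
  by apply/funext => x; rewrite mulN1r addrC.
rewrite (lT _ _ _ C D)// mulN1r => h.
have -> : T phi - T psi = - (- T phi + T psi) by rewrite opprD opprK.
rewrite normc_opp; apply: (le_lt_trans h).
by rewrite /d mulrA ltr_pdivrMr// (mulrC M) ltr_pM2l// ltrDl.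
Qed.

Lemma tempered_dirac a : tempered (@dirac_dist R n a).
Proof.
apply: (@tempered_bounded _ 1) => // f C mf C0 fC.
rewrite mul1r; apply: (le_trans (fC a)); apply: ler_piMr => //; exact: weight_le1.
Qed.

Lemma exp_dist_lin a (c : R[i]) f g (C D : R) : cmeas f -> cmeas g ->
  0 <= C -> 0 <= D -> decay C f -> decay D g ->
  exp_dist a (fun x => c * f x + g x) = c * exp_dist a f + exp_dist a g.
Proof.
move=> mf mg C0 D0 fC gD; have [IW hW] := @weight_integral_bound R n.
have [i1 _] := exp_dist_le a hW C0 mf fC; have [i2 _] := exp_dist_le a hW D0 mg gD.
have [i3 <-] := cintegrableZ c i1.
rewrite -(integralCD i3 i2); congr integralC; apply/funext => x.
by rewrite mulrDr mulrCA.
Qed.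

Lemma tempered_exp a : tempered (@exp_dist R n a).
Proof.
have [IW hW] := @weight_integral_bound R n.
apply: (@tempered_bounded _ (2 * `|IW|)).
- by rewrite mulr_ge0.
- by move=> c f g C D *; exact: (@exp_dist_lin a c f g C D).
- move=> f C mf C0 fC; have [_ h] := exp_dist_le a hW C0 mf fC.
  by apply: (le_trans h); rewrite -mulrA ler_wpM2l// mulrC ler_wpM2r// ler_norm.
Qed.

(** Limits of real and imaginary parts, so as to be defined on every function. *)
Definition comb phi : R[i] :=
  let u := fun k : K => phi (map_mx intr k) in
  (limn (fun N => complex.Re (cesaro_mean N u)) +i*
   limn (fun N => complex.Im (cesaro_mean N u)))%C.

Lemma comb_eq phi (s : R[i]) :
  (forall e : R, 0 < e -> exists N0, forall N, (N0 <= N)%N ->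
    nm (cesaro_mean N (fun k => phi (map_mx intr k)) - s) <= e) -> comb phi = s.
Proof.
move=> h; set u := fun k : K => phi (map_mx intr k).
have cR : (fun N => complex.Re (cesaro_mean N u)) @ \oo --> complex.Re s.
  apply/cvgrPdist_le => e e0; have [N0 hN] := h _ e0; exists N0 => // N /= /hN.
  by apply: le_trans; rewrite distrC -ReN -ReD Re_le_normc.
have cI : (fun N => complex.Im (cesaro_mean N u)) @ \oo --> complex.Im s.
  apply/cvgrPdist_le => e e0; have [N0 hN] := h _ e0; exists N0 => // N /= /hN.
  by apply: le_trans; rewrite distrC -ImN -ImD Im_le_normc.
by apply: complex_eq => /=; [exact: (cvg_lim _ cR)|exact: (cvg_lim _ cI)].
Qed.

Lemma lat1 (k : K) : lat 1 k = map_mx intr k :> 'rV[R]_n.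
Proof. by rewrite /lat scale1r. Qed.

Lemma comb_sum : exists2 S : R, 0 <= S & forall phi C, 0 <= C -> decay C phi ->
  has_sum (fun k : K => phi (map_mx intr k)) (comb phi) /\ nm (comb phi) <= C * S.
Proof.
have [S [S0 hS]] := @weight_lat_sum R n 1 ltr01; exists S => // phi C C0 fC.
have uC (k : K) : nm (phi (map_mx intr k)) <= C * weight (lat 1 k) by rewrite lat1.
have W0 (k : K) : 0 <= weight (lat 1 k : 'rV[R]_n) by exact: weight_ge0.
have [s us] := dominated_has_sum W0 hS C0 uC.
suff -> : comb phi = s by split => //; exact: (has_sum_le hS uC C0 us).
apply: comb_eq; apply: (@cesaro_cvg _ _ _ _ (C * S) us) => B.
apply: (le_trans (normc_sum _ _ _)); apply: le_trans (ler_wpM2l C0 (hS B)).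
by rewrite mulr_sumr ler_sum.
Qed.

Lemma has_sum_uniq (I : choiceType) (u : I -> R[i]) s1 s2 :
  has_sum u s1 -> has_sum u s2 -> s1 = s2.
Proof.
move=> h1 h2; apply/eqP; rewrite -subr_eq0; apply/eqP.
apply: ComplexField.Normc.eq0_normc; apply/eqP; rewrite eq_le normc_ge0 andbT.
apply/ler_addgt0Pr => e e0; have e2 : 0 < e / 2 by lra.
have [A hA] := h1 _ e2; have [B hB] := h2 _ e2.
have := hA _ (fsubsetUl A B); have := hB _ (fsubsetUr A B).
set X := \sum_(i <- _) _ => a1 a2; rewrite add0r.
have -> : s1 - s2 = (X - s2) - (X - s1) by ring.
by apply: (le_trans (normcB _ _)); lra.
Qed.

Lemma has_sum_lin (I : choiceType) (c : R[i]) (u v : I -> R[i]) s t :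
  has_sum u s -> has_sum v t -> has_sum (fun i => c * u i + v i) (c * s + t).
Proof.
move=> us vt e e0; pose d := e / (nm c + 1).
have c0 := normc_ge0 c.
have d0 : 0 < d by rewrite divr_gt0// ltr_wpDl.
have [A hA] := us _ d0; have [B hB] := vt _ d0.
exists (A `|` B)%fset => X; rewrite fsubUset => /andP[/hA h1 /hB h2].
rewrite big_split /= -mulr_sumr.
have -> : c * (\sum_(i <- X) u i) + \sum_(i <- X) v i - (c * s + t) =
  c * (\sum_(i <- X) u i - s) + (\sum_(i <- X) v i - t) by ring.
apply: (le_trans (normcD _ _)); rewrite normc_mul.
apply: (le_trans (lerD (ler_wpM2l c0 h1) h2)).
by rewrite /d -{2}[e / _]mul1r -mulrDl mulrCA divff ?mulr1// gt_eqF// ltr_wpDl.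
Qed.

Lemma tempered_comb : tempered comb.
Proof.
have [S S0 hS] := comb_sum; apply: (@tempered_bounded _ S) => //.
  move=> c f g C D mf mg C0 D0 fC gD.
  have [h1 _] := hS _ _ C0 fC; have [h2 _] := hS _ _ D0 gD.
  have cCD : 0 <= nm c * C + D by rewrite addr_ge0// mulr_ge0// normc_ge0.
  have fg : decay (nm c * C + D) (fun x => c * f x + g x).
    move=> x; apply: (le_trans (normcD _ _)); rewrite mulrDl lerD//.
    by rewrite normc_mul -mulrA ler_wpM2l// normc_ge0.
  have [h3 _] := hS _ _ cCD fg.
  exact: has_sum_uniq h3 (has_sum_lin c h1 h2).
by move=> f C _ C0 fC; rewrite mulrC; exact: (hS _ _ C0 fC).2.
Qed.

(** The double sum of characters factors over the coordinates, each factor being the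
    squared modulus of a Dirichlet kernel. *)
Lemma cesaro_char (p : R) (N : nat) (x : 'rV[R]_n) : p != 0 ->
  cesaro_mean N (fun k => expi (dotp (lat (2 * pi / p) k) x)) = ((fejer_kernel p N x)%:C)%C.
Proof.
move=> p0; rewrite /cesaro_mean.
pose G (j : 'I_n) (c d : 'I_N.+1) : R[i] := expi ((c%:R - d%:R) * (2 * pi * x 0 j / p)).
have -> : \sum_(a : {ffun 'I_n -> 'I_N.+1}) \sum_(b : {ffun 'I_n -> 'I_N.+1})
    expi (dotp (lat (2 * pi / p) (diff_pt b a)) x) =
    \prod_j \sum_c \sum_d G j c d.
  rewrite bigA_distr_bigA; apply: eq_bigr => a _.
  rewrite bigA_distr_bigA; apply: eq_bigr => b _.
  rewrite /dotp expi_sum; apply: eq_bigr => j _; congr expi.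
  by rewrite /lat !mxE intrB -!pmulrn; field.
under eq_bigr do rewrite dirichlet_sqr.
rewrite -(rmorph_prod (real_complex R)) -realcM; congr (_%:C)%C.
have -> : N.+1%:R ^- n = \prod_(j < n) N.+1%:R^-1 :> R.
  by rewrite prodr_const card_ord exprVn.
by rewrite -big_split.
Qed.

Lemma cesaro_opp (N : nat) (u : K -> R[i]) : cesaro_mean N (fun k => u (- k)) = cesaro_mean N u.
Proof.
rewrite /cesaro_mean exchange_big /=; congr (_ * _); apply: eq_bigr => a _.
apply: eq_bigr => b _; congr u; apply/rowP => j; rewrite !mxE opprB//.
Qed.

Lemma cesaro_exp_dist (p : R) (N : nat) f C : p != 0 -> 0 <= C -> cmeas f -> decay C f ->
  cesaro_mean N (fun k => exp_dist (lat (2 * pi / p) k) f) =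
  integralC (fun x => ((fejer_kernel p N x)%:C)%C * f x).
Proof.
move=> p0 C0 mf fC; have [IW hW] := @weight_integral_bound R n.
have ci a : cintegrable (fun x => expi (dotp a x) * f x).
  by have [] := exp_dist_le a hW C0 mf fC.
have -> : (fun x => ((fejer_kernel p N x)%:C)%C * f x) = fun x =>
  ((N.+1%:R ^- n)%:C)%C * \sum_(a : {ffun 'I_n -> 'I_N.+1})
    \sum_(b : {ffun 'I_n -> 'I_N.+1})
       expi (dotp (lat (2 * pi / p) (diff_pt b a)) x) * f x.
  apply/funext => x; rewrite -cesaro_char// /cesaro_mean -mulrA mulr_suml.
  by congr (_ * _); apply: eq_bigr => a _; rewrite mulr_suml.
pose F (a b : {ffun 'I_n -> 'I_N.+1}) (x : 'rV[R]_n) :=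
  expi (dotp (lat (2 * pi / p) (diff_pt b a)) x) * f x.
have ci1 (a : {ffun 'I_n -> 'I_N.+1}) :=
  @cintegrable_sum _ _ _ (index_enum {ffun 'I_n -> 'I_N.+1}) (F a) (fun b => ci _).
have ci2 := @cintegrable_sum _ _ _ (index_enum {ffun 'I_n -> 'I_N.+1})
  (fun c x => \sum_b F c b x) (fun c => (ci1 c).1).
have [_ ->] := cintegrableZ ((N.+1%:R ^- n)%:C)%C ci2.1.
rewrite ci2.2 /cesaro_mean; congr (_ * _); apply: eq_bigr => a _.
by rewrite (ci1 a).2.
Qed.

(** The Cesaro means of the series of exponentials are the integrals of phi against
    Fejer kernels of period 1. They tend to the sum of the series by [cesaro_cvg] and
    to the sum of phi over Z^n by [fejer_sampling]. *)
Theorem poisson phi : schwartz phi ->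
  has_sum (fun k : K => exp_dist (lat (2 * pi) k) phi) (comb phi).
Proof.
move=> sp; have [C C0 hC] := schwartz_decay0 sp.
have mp := schwartz_cmeas sp.
have [D D0 hD] := fourier_coef_decay sp.
have [S [S0 hS]] := @weight_lat_sum R n 1 ltr01.
have W0 (k : K) : 0 <= weight (lat 1 k : 'rV[R]_n) by exact: weight_ge0.
have [s us] := dominated_has_sum W0 hS D0 hD.
have uB (B : {fset K}) : nm (\sum_(k <- B) exp_dist (lat (2 * pi) k) phi) <= D * S.
  apply: (le_trans (normc_sum _ _ _)); apply: le_trans (ler_wpM2l D0 (hS B)).
  by rewrite mulr_sumr ler_sum.
suff <- : s = comb phi by [].
have [S' S'0 hS'] := comb_sum; have [hs _] := hS' _ _ C0 hC.
have hs1 : has_sum (fun k : K => phi (lat 1 k)) (comb phi).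
  by move=> e /hs[A hA]; exists A => B /hA; under eq_bigr do rewrite -lat1.
have samp := fejer_sampling ltr01 C0 mp hC (schwartz_weighted_lip sp) hs1.
apply/eqP; rewrite -subr_eq0; apply/eqP.
apply: ComplexField.Normc.eq0_normc; apply/eqP; rewrite eq_le normc_ge0 andbT.
apply/ler_addgt0Pr => e e0; have e2 : 0 < e / 2 by lra.
have [N1 h1] := cesaro_cvg us uB e2; have [N2 h2] := samp _ e2.
have := h1 (maxn N1 N2) (leq_maxl _ _); have := h2 (maxn N1 N2) (leq_maxr _ _).
rewrite -(cesaro_exp_dist _ (oner_neq0 _) C0 mp hC) divr1 expr1n.
have -> : ((1 : R)%:C)%C = 1 by [].
rewrite mul1r; set X := cesaro_mean _ _ => a1 a2; rewrite add0r.
have -> : s - comb phi = (X - comb phi) - (X - s) by ring.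
by apply: (le_trans (normcB _ _)); lra.
Qed.

End comb.

(** * Spectral pieces of the comb *)

Section spectral_pieces.
Context {R : realType} {n : nat}.
Local Notation nm := (@ComplexField.Normc.normc R).
Local Notation K := 'rV[int]_n.
Implicit Types (f phi psi : 'rV[R]_n -> R[i]).

Lemma schwartz_scale (p : R) phi : 0 < p -> schwartz phi ->
  [/\ cmeas (fun x => phi (p *: x)), weighted_lip (fun x => phi (p *: x)) &
      exists2 C, 0 <= C & decay C (fun x => phi (p *: x))].
Proof.
move=> p0 sp; have [C C0 hC] := schwartz_decay0 sp; split.
- have [sr si _] := sp; have cp : continuous (fun x : 'rV[R]_n => p *: x).
    by move=> x; exact: (@scaler_continuous _ _ p x).
  apply: cmeas_continuous => x.
    exact: (cvg_comp _ _ (cp x) ((sr [::]).1 (p *: x))).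
  exact: (cvg_comp _ _ (cp x) ((si [::]).1 (p *: x))).
- by apply: weighted_lip_scale => //; exact: schwartz_weighted_lip.
- exists (C * (1 + p ^- 2) ^+ n); last exact: decay_scale.
  by rewrite mulr_ge0// exprn_ge0// addr_ge0// invr_ge0 sqr_ge0.
Qed.

Lemma dyadic_class phi0 j : schwartz phi0 ->
  [/\ cmeas (dyadic phi0 j), weighted_lip (dyadic phi0 j) &
      exists2 C, 0 <= C & decay C (dyadic phi0 j)].
Proof.
move=> sp; case: j => [|j] /=.
  split; [exact: schwartz_cmeas|exact: schwartz_weighted_lip|].
  by have [C C0 hC] := schwartz_decay0 sp; exists C.
have p1 : 0 < 2 ^- j.+1 :> R by rewrite invr_gt0 exprn_gt0.
have p2 : 0 < 2 ^- j :> R by rewrite invr_gt0 exprn_gt0.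
have [m1 l1 [C1 C10 d1]] := schwartz_scale p1 sp.
have [m2 l2 [C2 C20 d2]] := schwartz_scale p2 sp.
split; [exact: cmeasB|exact: weighted_lipB|].
by exists (C1 + C2); [exact: addr_ge0|exact: decayB].
Qed.

Lemma enormZ (c : R) (x : 'rV[R]_n) : 0 <= c -> enorm (c *: x) = c * enorm x.
Proof.
move=> c0; rewrite /enorm (_ : dotp _ _ = c ^+ 2 * dotp x x).
  by rewrite sqrtrM ?sqr_ge0// sqrtr_sqr ger0_norm.
by rewrite /dotp mulr_sumr; apply: eq_bigr => j _; rewrite !mxE; ring.
Qed.

Lemma dyadic_support phi0 j x : cutoff phi0 ->
  3 / 2 * 2 ^+ j <= enorm x -> dyadic phi0 j x = 0.
Proof.
move=> [_ _ h0]; case: j => [|j] hx /=; first by apply: h0; rewrite expr0 mulr1 in hx.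
have z (i : nat) : (i <= j.+1)%N -> phi0 (2 ^- i *: x) = 0.
  move=> ij; apply: h0; rewrite enormZ ?invr_ge0 ?exprn_ge0//.
  rewrite [leRHS]mulrC ler_pdivlMr ?exprn_gt0//; apply: le_trans hx.
  by rewrite ler_pM2l// ler_weXn2l// ler1n.
by rewrite !z// subrr.
Qed.

Lemma dyadic_bounded phi0 : schwartz phi0 -> exists2 B : R, 0 <= B &
  forall j x, nm (dyadic phi0 j x) <= B.
Proof.
move=> sp; have [C C0 hC] := schwartz_decay0 sp.
have bC x : nm (phi0 x) <= C.
  by apply: (le_trans (hC x)); apply: ler_piMr => //; exact: weight_le1.
exists (C + C); first exact: addr_ge0.
case=> [|j] x /=; first by apply: (le_trans (bC x)); rewrite lerDl.
by apply: (le_trans (normcB _ _)); rewrite lerD.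
Qed.

Lemma lat_enorm (M : nat) (k : K) : k \notin box M ->
  2 * pi * M%:R <= enorm (lat (2 * pi) k : 'rV[R]_n).
Proof.
rewrite in_box negb_forall => /existsP; case=> i; rewrite -ltnNge => Mi.
apply: le_trans (coord_le_enorm _ i); rewrite /lat !mxE normrM ger0_norm; last first.
  by rewrite mulr_ge0// pi_ge0.
rewrite ler_wpM2l ?mulr_ge0 ?pi_ge0// -intr_norm pmulrn ler_int.
by move: (k 0 i : int) Mi => z; lia.
Qed.

(** A coordinate of k beyond 2^j gives 2 pi k a norm of at least 2 pi 2^j, which
    exceeds the radius (3/2) 2^j of the support. *)
Lemma dyadic_lat0 phi0 j (k : K) : cutoff phi0 -> k \notin box (2 ^ j) ->
  dyadic phi0 j (lat (2 * pi) k) = 0.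
Proof.
move=> c0 /lat_enorm h; apply: dyadic_support => //; apply: le_trans h.
rewrite natrX ler_wpM2r ?exprn_ge0//; have := @pi_ge2 R; lra.
Qed.

Definition comb_piece phi0 (j : nat) : 'rV[R]_n -> R[i] := fun x =>
  \sum_(k <- box (2 ^ j)) dyadic phi0 j (lat (2 * pi) k) * expi (dotp (lat (2 * pi) k) x).

Lemma continuous_comb_piece phi0 j :
  continuous (comb_piece phi0 j : 'rV[R]_n -> R[i]^o).
Proof.
pose L := \sum_(k <- @box n (2 ^ j)) nm (dyadic phi0 j (lat (2 * pi) k)) *
  (2 * enorm (lat (2 * pi) k : 'rV[R]_n)).
apply: (@lipc_continuous _ _ _ L) => x y.
rewrite /comb_piece -sumrB; apply: (le_trans (normc_sum _ _ _)).
rewrite mulr_suml; apply: ler_sum => k _; rewrite -mulrBr normc_mul.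
rewrite -[leRHS]mulrA ler_wpM2l ?normc_ge0//; apply: (le_trans (expi_lip _ _)).
rewrite -mulrA ler_wpM2l// /dotp -sumrB mulr_sumr.
apply: (le_trans (ler_norm_sum _ _ _)); apply: ler_sum => i _.
by rewrite -mulrBr normrM ler_wpM2r// coord_le_enorm.
Qed.

Lemma card_box M : \sum_(k <- @box n M) 1 = ((M.*2.+1) ^ n)%:R :> R.
Proof. by rewrite sum_box sumr_const card_ffun !card_ord. Qed.

(** Bounded coefficients, times the number of points of the box, which is at most
    (3 * 2^j)^n. *)
Lemma comb_piece_le phi0 : schwartz phi0 -> exists B : R, forall j x,
  2 `^ (j%:R * - n%:R) * nm (comb_piece phi0 j x) <= B.
Proof.
move=> sp; have [B B0 hB] := dyadic_bounded sp.
exists (3 ^+ n * B) => j x.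
have g_le : nm (comb_piece phi0 j x) <= ((2 ^ j).*2.+1 ^ n)%:R * B.
  apply: (le_trans (normc_sum _ _ _)); rewrite -card_box mulr_suml.
  by apply: ler_sum => k _; rewrite normc_mul normc_expi mulr1 mul1r.
have -> : 2 `^ (j%:R * - n%:R) = (2 ^+ j) ^- n :> R.
  by rewrite mulrN powRN -natrM powR_mulrn// exprM.
have t0 : 0 < 2 ^+ j :> R by rewrite exprn_gt0.
rewrite mulrC ler_pdivrMr ?exprn_gt0//; apply: (le_trans g_le).
rewrite mulrAC ler_wpM2r// -exprMn natrX lerXn2r ?nnegrE ?mulr_ge0//.
rewrite -natrX -natrM ler_nat; have := expn_gt0 2 j; lia.
Qed.

Lemma fourier_cst_sqr : @fourier_cst R n * (((2 * pi) ^+ n)%:C)%C * @fourier_cst R n = 1.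
Proof.
have p0 : 0 < 2 * pi :> R by rewrite mulr_gt0// pi_gt0.
rewrite /fourier_cst -!realcM; apply: (congr1 (fun x : R => (x%:C)%C)).
rewrite mulrAC -powRD; last by apply/implyP => _; rewrite gt_eqF.
rewrite -opprD -splitr powRN powR_mulrn ?ltW// mulVf// expf_neq0// gt_eqF//.
Qed.

(** The Cesaro means of the Fourier transform of h = phi_j psi^v over Z^n are
    integrals of h against Fejer kernels of period 2 pi, which converge to the sum of
    h over 2 pi Z^n. The factor (2 pi)^n thus produced cancels the normalising
    constants of the two Fourier transforms. *)
Lemma comb_piece_spectral phi0 j psi : cutoff phi0 -> schwartz psi ->
  comb (fourier (fun x => dyadic phi0 j x * fourier_inv psi x)) =
  regular (comb_piece phi0 j) psi.
Proof.
move=> c0 sps; have [sp _ _] := c0.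
have p0 : 0 < 2 * pi :> R by rewrite mulr_gt0// pi_gt0.
have pn0 : 2 * pi != 0 :> R by rewrite gt_eqF.
have [mD lD [C C0 dD]] := dyadic_class j sp.
have [B [L [B0 L0 bl]]] := fourier_inv_lip sps.
pose h x := dyadic phi0 j x * fourier_inv psi x.
have mh : cmeas h by apply: cmeasM => //; exact: bounded_lip_cmeas bl.
have CB0 : 0 <= C * B by rewrite mulr_ge0.
have dh : decay (C * B) h by exact: decayM C0 dD bl.
have lh : weighted_lip h by exact: weighted_lipM C0 B0 L0 dD lD bl.
have hs : has_sum (fun k => h (lat (2 * pi) k)) (\sum_(k <- box (2 ^ j)) h (lat (2 * pi) k)).
  by apply: has_sum_fin => k kb; rewrite /h dyadic_lat0// mul0r.
have samp := fejer_sampling p0 CB0 mh dh lh hs.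
set s := \sum_(k <- box _) _ in hs samp.
pose q := nm (@fourier_cst R n).
(* the opposite sign of the frequency is absorbed by the symmetry of the means *)
have cE N : cesaro_mean N (fun k => fourier h (map_mx intr k)) =
    @fourier_cst R n * integralC (fun x => ((fejer_kernel (2 * pi) N x)%:C)%C * h x).
  rewrite -(cesaro_exp_dist _ pn0 CB0 mh dh) divff// -[in RHS]cesaro_opp.
  rewrite /cesaro_mean mulrCA; congr (_ * _); rewrite mulr_sumr; apply: eq_bigr => a _.
  rewrite mulr_sumr; apply: eq_bigr => b _; rewrite /fourier /exp_dist /regular.
  congr (_ * integralC _); apply/funext => x; congr (expi _ * _).
  rewrite lat1 /dotp -sumrN; apply: eq_bigr => i _.
  by rewrite !mxE rmorphN /= mulNr mulrC.
transitivity (@fourier_cst R n * (((2 * pi) ^+ n)%:C)%C * s).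
  apply: comb_eq => e e0.
  have q0 : 0 <= q by exact: normc_ge0.
  have d0 : 0 < e / (q + 1) by rewrite divr_gt0// ltr_wpDl.
  have [N0 hN] := samp _ d0; exists N0 => N /hN h1.
  rewrite cE -mulrA -mulrBr normc_mul.
  apply: (le_trans (ler_wpM2l q0 h1)); rewrite mulrCA; apply: ler_piMr; first exact: ltW.
  by rewrite ler_pdivrMr ?ltr_wpDl// mul1r lerDl.
have [IW hW] := @weight_integral_bound R n.
have [D D0 dpsi] := schwartz_decay0 sps; have mpsi := schwartz_cmeas sps.
have ci (k : K) : cintegrable (fun x => expi (dotp (lat (2 * pi) k) x) * psi x).
  by have [] := exp_dist_le (lat (2 * pi) k) hW D0 mpsi dpsi.
have ciZ (k : K) := cintegrableZ (dyadic phi0 j (lat (2 * pi) k)) (ci k).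
have [_ E] := @cintegrable_sum _ _ _ (box (2 ^ j)) (fun k x =>
  dyadic phi0 j (lat (2 * pi) k) * (expi (dotp (lat (2 * pi) k) x) * psi x))
  (fun k => (ciZ k).1).
have -> : regular (comb_piece phi0 j) psi = integralC (fun x => \sum_(k <- box (2 ^ j))
  dyadic phi0 j (lat (2 * pi) k) * (expi (dotp (lat (2 * pi) k) x) * psi x)).
  congr integralC; apply/funext => x; rewrite /comb_piece mulr_suml.
  by apply: eq_bigr => k _; rewrite mulrA.
rewrite E /s mulr_sumr; apply: eq_bigr => k _; rewrite (ciZ k).2 /h mulrCA; congr (_ * _).
rewrite /fourier_inv mulrA fourier_cst_sqr mul1r; congr integralC.
by apply/funext => x; rewrite dotpC.
Qed.

Lemma comb_zygmund phi0 : cutoff phi0 -> zygmund phi0 (- n%:R) (@comb R n).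
Proof.
move=> c0; split; first exact: tempered_comb.
exists (comb_piece phi0); split.
  move=> j; split; first exact: continuous_comb_piece.
  by move=> psi sps; exact: comb_piece_spectral.
have [sp _ _] := c0; have [B hB] := comb_piece_le sp.
apply: (@le_lt_trans _ _ B%:E); last exact: ltry.
by apply: ge_ereal_sup => _ [j _ [x _ <-]]; rewrite lee_fin.
Qed.

End spectral_pieces.

Theorem theorem2p1 (R : realType) (n : nat) (hn : (0 < n)%N) :
  exists T : ('rV[R]_n -> R[i]) -> R[i],
    [/\ sums_to
          (fun k : 'rV[int]_n => exp_dist ((2 * pi) *: map_mx intr k)) T,
        sums_to (fun k : 'rV[int]_n => dirac_dist (map_mx intr k)) T &
        forall phi0 : 'rV[R]_n -> R[i], cutoff phi0 ->
          zygmund phi0 (- n%:R) T].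
Proof.
exists comb; split.
- split; [by move=> k; exact: tempered_exp|exact: tempered_comb|].
  by move=> phi sp; apply: has_sum_cvg; exact: poisson.
- split; [by move=> k; exact: tempered_dirac|exact: tempered_comb|].
  move=> phi sp; apply: has_sum_cvg; have [C C0 hC] := schwartz_decay0 sp.
  by have [S S0 hS] := @comb_sum R n; have [] := hS _ _ C0 hC.
- by move=> phi0; exact: comb_zygmund.
Qed.
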